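(* Let $l_1>0$ and $\varepsilon\ge 1$. For $v\in[-1,1]$ consider the equation $$F(v):=\mathbb{E}_{(Z_1,Z_2)\sim\mathrm{BVN}(\rho)}\Big[1\wedge e^{-l_1Z_1-l_1^2/2}\wedge e^{-l_1Z_2-l_1^2/2}\Big]-2v\Phi(-l_1/2)=0,$$ where $\rho=\rho(v)$ is $\rho_{\mathrm{crn}}=v$ (CRN), $\rho_{\mathrm{refl}}=v+\varepsilon^{-1}(1-v)$ (reflection), or $\rho_{\mathrm{gcrn}}=1$ (GCRN). The solutions are: (i) GCRN: $v_{\mathrm{gcrn}}=1$. (ii) CRN: $v_{\mathrm{crn}}\in(0,1)$ and $v_u=1$. (iii) Reflection with $\varepsilon>1$: $v_{\mathrm{refl}}\in(v_{\mathrm{crn}},1)$ and $v_u=1$; moreover $v_{\mathrm{refl}}$ is a decreasing function of $\varepsilon\in(1,\infty)$ with $v_{\mathrm{refl}}\to 1$ as $\varepsilon\to1$ and $v_{\mathrm{refl}}\to v_{\mathrm{crn}}$ as $\varepsilon\to\infty$. The solutions $v_{\mathrm{crn}},v_{\mathrm{refl}}$ are decreasing in $l_1$, and $\lim_{l_1\to0}v_{\mathrm{crn}}=\lim_{l_1\to0}v_{\mathrm{refl}}=1$, $\lim_{l_1\to\infty}v_{\mathrm{crn}}=\lim_{l_1\to\infty}v_{\mathrm{refl}}=0$. The solution $v_u=1$ is unstable for both the CRN and reflection couplings, in the sense that $\partial_vF(v)\to\infty$ as $v\nearrow1$; the solutions $v_{\mathrm{crn}}$, $v_{\mathrm{refl}}$,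 $v_{\mathrm{gcrn}}$ under the respective couplings are stable, in the sense that $\partial_vF$ is strictly negative at these values.
   Context: $\Phi$ is the standard normal cdf; $\mathrm{BVN}(\rho)$ denotes the bivariate normal distribution with zero means, unit variances and correlation $\rho$. (In the paper, $l_1$ is the rescaled step size and $\varepsilon$ the limiting ellipticity $\lim_d \{\mathrm{tr}(\Sigma_{(d)}^{-1})/d\}\{\mathrm{tr}(\Sigma_{(d)})/d\}\ge 1$ of a sequence of Gaussian targets $\mathcal{N}_d(0,\Sigma_{(d)})$.) *)

(* Defs.v *)
From Stdlib Require Import Reals.
From Coquelicot Require Import Coquelicot.
Open Scope R_scope.

Definition phi (x : R) : R := exp (- x ^ 2 / 2) / sqrt (2 * PI).

Definition Phi (x : R) : R := RInt_gen phi (Rbar_locally m_infty) (at_point x).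

(* Expectation of g(Z1,Z2) with (Z1,Z2) ~ BVN(rho), |rho| <= 1, via the standard
   representation Z1 = X, Z2 = rho X + sqrt(1-rho^2) Y with X,Y iid N(0,1)
   (this also covers the degenerate case rho = 1). *)
Definition E_BVN (rho : R) (g : R -> R -> R) : R :=
  RInt_gen (fun x =>
     RInt_gen (fun y => phi x * phi y * g x (rho * x + sqrt (1 - rho ^ 2) * y))
              (Rbar_locally m_infty) (Rbar_locally p_infty))
   (Rbar_locally m_infty) (Rbar_locally p_infty).

Definition acc (l : R) (z1 z2 : R) : R :=
  Rmin 1 (Rmin (exp (- l * z1 - l ^ 2 / 2)) (exp (- l * z2 - l ^ 2 / 2))).

Definition F (l : R) (rho : R -> R) (v : R) : R :=
  E_BVN (rho v) (acc l) - 2 * v * Phi (- l / 2).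

Definition rho_crn (v : R) : R := v.
Definition rho_refl (eps : R) (v : R) : R := v + / eps * (1 - v).
Definition rho_gcrn (v : R) : R := 1.

(* Main.v *)
Require Import Defs.
From Stdlib Require Import Reals.
From Coquelicot Require Import Coquelicot.
From Stdlib Require Import Lra FunctionalExtensionality ClassicalEpsilon.
Open Scope R_scope.

(* The acceptance function depends on [max (Z1, Z2)] only, whose density is
   [2 phi(m) Phi(tau m)] with [tau = sqrt ((1 - rho) / (1 + rho))].  With [u = 1 - v] and
   [damp l m = min (1, exp (- l m - l^2 / 2))] this gives
   [F = 2 Phi(- l / 2) u - gap l tau], where [gap l] vanishes at 0 and, after averaging the
   integrand over [m] and [- m], is seen to be increasing and concave in [tau >= 0].
   Both couplings have [tau = sqrt (u / (2 k - u))] with a constant [k >= 1], and [tau / u]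
   is strictly decreasing for [u <= 1]; hence [gap l tau / u] is strictly decreasing and
   crosses the level [2 Phi(- l / 2)] exactly once, which is the nontrivial root.
   Monotonicity in [l] is Chebyshev's inequality: [1 - gap / (2 Phi(- l / 2))] is the mean of
   [2 Phi(tau m)] under the density proportional to [phi * damp l], which has a monotone
   likelihood ratio in [l]. *)

(** The main obstacle is [E_BVN], an iterated improper integral. It is cut down to the square
    [[-B, B]^2], where the joint density times [damp] is a symmetric kernel, so that the double
    integral is twice the one over the triangle below the diagonal. The error is a normal tail at
    [kappa * B], uniform over the square, and vanishes as [B] grows.

    Passages to the limit rest on explicit bounds: integrands are dominated by [C / (1 + x ^ 2)],
    and [gap] is differentiated under the integral by a quadratic Taylor remainder.

    Concavity of [gap] yields only weak inequalities; strictness in the uniqueness and stability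
    claims comes from [tau]. The square root in [tau] also explains both ends of the picture: near
    [u = 0], [gap] is of order [sqrt u] and beats the linear term, which forces a second root and
    makes the derivative of [F] blow up at [v = 1]. *)

(** * Continuity and finite integrals of everywhere continuous functions *)

Lemma cont_plus (f g : R -> R) (x : R) :
  continuous f x -> continuous g x -> continuous (fun y => f y + g y) x.
Proof. intros; now apply (continuous_plus f g x). Qed.

Lemma cont_minus (f g : R -> R) (x : R) :
  continuous f x -> continuous g x -> continuous (fun y => f y - g y) x.
Proof. intros; now apply (continuous_minus f g x). Qed.

Lemma cont_opp (f : R -> R) (x : R) :
  continuous f x -> continuous (fun y => - f y) x.
Proof. intros; now apply (continuous_opp f x). Qed.

Lemma cont_mult (f g : R -> R) (x : R) :
  continuous f x -> continuous g x -> continuous (fun y => f y * g y) x.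
Proof. intros; now apply (continuous_mult f g x). Qed.

Lemma cont_const (c x : R) : continuous (fun _ : R => c) x.
Proof. apply continuous_const. Qed.

Lemma cont_id (x : R) : continuous (fun y : R => y) x.
Proof. apply continuous_id. Qed.

Lemma cont_comp (f g : R -> R) (x : R) :
  continuous f x -> (forall y, continuous g y) -> continuous (fun y => g (f y)) x.
Proof. intros Hf Hg; apply (continuous_comp f g x); auto. Qed.

Lemma cont_div (f : R -> R) (c x : R) :
  continuous f x -> continuous (fun y => f y / c) x.
Proof. intros; apply cont_mult; [easy | apply cont_const]. Qed.

Lemma cont_pow (f : R -> R) (n : nat) (x : R) :
  continuous f x -> continuous (fun y => f y ^ n) x.
Proof.
  intros H; induction n as [|n IH]; simpl; [apply cont_const | now apply cont_mult].
Qed.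

Lemma cont_Rabs (f : R -> R) (x : R) :
  continuous f x -> continuous (fun y => Rabs (f y)) x.
Proof. intros; now apply continuous_Rabs_comp. Qed.

Lemma cont_exp (f : R -> R) (x : R) :
  continuous f x -> continuous (fun y => exp (f y)) x.
Proof. intros; now apply continuous_exp_comp. Qed.

Lemma cont_Rmin (f g : R -> R) (x : R) :
  continuous f x -> continuous g x -> continuous (fun y => Rmin (f y) (g y)) x.
Proof.
  intros Hf Hg.
  apply (continuous_ext (fun y => (f y + g y - Rabs (f y - g y)) / 2)).
  - intros y; unfold Rmin, Rabs; destruct (Rle_dec (f y) (g y));
      destruct (Rcase_abs (f y - g y)); lra.
  - apply cont_div, cont_minus; [now apply cont_plus | now apply cont_Rabs, cont_minus].
Qed.

Lemma cont_Rmax (f g : R -> R) (x : R) :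
  continuous f x -> continuous g x -> continuous (fun y => Rmax (f y) (g y)) x.
Proof.
  intros Hf Hg.
  apply (continuous_ext (fun y => (f y + g y + Rabs (f y - g y)) / 2)).
  - intros y; unfold Rmax, Rabs; destruct (Rle_dec (f y) (g y));
      destruct (Rcase_abs (f y - g y)); lra.
  - apply cont_div, cont_plus; [now apply cont_plus | now apply cont_Rabs, cont_minus].
Qed.

Lemma lipschitz_continuous (f : R -> R) (L x : R) :
  (forall y, Rabs (f y - f x) <= L * Rabs (y - x)) -> continuous f x.
Proof.
  intros H; apply filterlim_locally; intros eps.
  (* No sign is assumed for [L]; dividing by [Rabs L + 1] is always possible. *)
  assert (HL : 0 < Rabs L + 1) by (pose proof (Rabs_pos L); lra).
  assert (Hd : 0 < eps / (Rabs L + 1)) by (apply Rdiv_lt_0_compat; [apply eps | easy]).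
  exists (mkposreal _ Hd); intros y Hy.
  change (Rabs (f y - f x) < eps); change (Rabs (y - x) < eps / (Rabs L + 1)) in Hy.
  apply Rmult_lt_compat_l with (r := Rabs L + 1) in Hy; [|easy].
  replace ((Rabs L + 1) * (eps / (Rabs L + 1))) with (pos eps) in Hy by (field; lra).
  specialize (H y); pose proof (Rle_abs L); pose proof (Rabs_pos (y - x)); nra.
Qed.

(** Coquelicot lemmas leave equalities typed in the carrier of a structure; restated at [R] they are
    accessible to [ring] and [field]. *)
Ltac eqR := match goal with |- ?a = ?b => change (@eq R a b) end.

Ltac cont :=
  repeat lazymatch goal with
  | |- continuous (fun _ => ?c) _ => apply (cont_const c)
  | |- continuous (fun y => y) _ => apply cont_id
  | |- continuous (fun y => @?f y + @?g y) _ => apply (cont_plus f g)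
  | |- continuous (fun y => @?f y - @?g y) _ => apply (cont_minus f g)
  | |- continuous (fun y => - @?f y) _ => apply (cont_opp f)
  | |- continuous (fun y => @?f y * @?g y) _ => apply (cont_mult f g)
  | |- continuous (fun y => @?f y / ?c) _ => apply (cont_div f c)
  | |- continuous (fun y => @?f y ^ ?n) _ => apply (cont_pow f n)
  | |- continuous (fun y => exp (@?f y)) _ => apply (cont_exp f)
  | |- continuous (fun y => Rabs (@?f y)) _ => apply (cont_Rabs f)
  | |- continuous (fun y => Rmin (@?f y) (@?g y)) _ => apply (cont_Rmin f g)
  | |- continuous (fun y => Rmax (@?f y) (@?g y)) _ => apply (cont_Rmax f g)
  end; auto.

Lemma ex_RInt_cont (f : R -> R) (a b : R) : (forall x, continuous f x) -> ex_RInt f a b.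
Proof. intros H; apply (ex_RInt_continuous (V := R_CompleteNormedModule)); auto. Qed.

Lemma RInt_derive_cont (F f : R -> R) (a b : R) :
  (forall x, is_derive F x (f x)) -> (forall x, continuous f x) -> RInt f a b = F b - F a.
Proof.
  intros HF Hf; apply is_RInt_unique.
  apply (is_RInt_derive (V := R_CompleteNormedModule)); auto.
Qed.

Lemma RInt_split (f : R -> R) (a b c : R) :
  (forall x, continuous f x) -> RInt f a c = RInt f a b + RInt f b c.
Proof.
  intros H; symmetry.
  apply (RInt_Chasles (V := R_CompleteNormedModule)); now apply ex_RInt_cont.
Qed.

Lemma RInt_mult_l (f : R -> R) (c a b : R) :
  (forall x, continuous f x) -> RInt (fun x => c * f x) a b = c * RInt f a b.
Proof. intros H; now apply (RInt_scal (V := R_CompleteNormedModule)), ex_RInt_cont. Qed.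

Lemma RInt_sum (f g : R -> R) (a b : R) :
  (forall x, continuous f x) -> (forall x, continuous g x) ->
  RInt (fun x => f x + g x) a b = RInt f a b + RInt g a b.
Proof. intros Hf Hg; apply (RInt_plus (V := R_CompleteNormedModule)); now apply ex_RInt_cont. Qed.

Lemma RInt_swap_opp (f : R -> R) (a b : R) :
  (forall x, continuous f x) -> RInt f b a = - RInt f a b.
Proof. intros H; symmetry; now apply (opp_RInt_swap (V := R_CompleteNormedModule)), ex_RInt_cont. Qed.

Lemma RInt_affine (f : R -> R) (u v a b : R) :
  (forall x, continuous f x) ->
  u * RInt (fun x => f (u * x + v)) a b = RInt f (u * a + v) (u * b + v).
Proof.
  intros H.
  rewrite <- RInt_mult_l.
  - apply (RInt_comp_lin (V := R_CompleteNormedModule)), ex_RInt_cont, H.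
  - intros x; apply (cont_comp (fun x => u * x + v)); [cont | easy].
Qed.

Lemma RInt_reflect (f : R -> R) (a b : R) :
  (forall x, continuous f x) -> RInt (fun x => f (- x)) a b = RInt f (- b) (- a).
Proof.
  intros H; pose proof (RInt_affine f (-1) 0 a b H) as E.
  replace (-1 * a + 0) with (- a) in E by ring; replace (-1 * b + 0) with (- b) in E by ring.
  rewrite (RInt_swap_opp f (- a)), <- E by easy.
  rewrite (RInt_ext (fun x => f (- x)) (fun x => f (-1 * x + 0))).
  - assert (O : forall t : R, t = - (-1 * t)) by (intros; ring); apply O.
  - intros x _; f_equal; ring.
Qed.

(** * Integration over the line *)

Definition integral (f : R -> R) : R :=
  RInt_gen f (Rbar_locally m_infty) (Rbar_locally p_infty).

(** The dominating function is the derivative of [C * atan], so tails of integrals are controlled by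
    tails of [atan]. The class is large enough for [phi] times any continuous function of quadratic
    growth. *)
Definition integrable (f : R -> R) : Prop :=
  (forall x, continuous f x) /\ exists C, forall x, Rabs (f x) <= C / (1 + x ^ 2).

(** By [atan_inv], [PI / 2 - atan x] is [atan (/ x)] for positive [x], so continuity of [atan] at 0
    suffices. *)
Lemma atan_near_half_PI (eps : posreal) : exists M, forall x, M < x -> PI / 2 - eps < atan x.
Proof.
  assert (H : continuous atan 0).
  { apply (ex_derive_continuous (V := R_NormedModule)); eexists; apply is_derive_atan. }
  apply filterlim_locally with (eps := eps) in H; destruct H as [d Hd].
  exists (/ d); intros x Hx.
  assert (Hd0 := cond_pos d); assert (Hx0 : 0 < / d) by now apply Rinv_0_lt_compat.
  assert (Hi : 0 < / x) by (apply Rinv_0_lt_compat; lra).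
  specialize (Hd (/ x)).
  assert (B : ball 0 d (/ x)).
  { change (Rabs (/ x - 0) < d); rewrite Rminus_0_r, Rabs_pos_eq by lra.
    rewrite <- (Rinv_inv d); apply Rinv_lt_contravar; [nra | easy]. }
  apply Hd in B; change (Rabs (atan (/ x) - atan 0) < eps) in B.
  rewrite atan_0, atan_inv in B by lra.
  apply Rabs_def2 in B; lra.
Qed.

Lemma atan_near_minus_half_PI (eps : posreal) :
  exists M, forall x, x < M -> atan x < - PI / 2 + eps.
Proof.
  destruct (atan_near_half_PI eps) as [M HM]; exists (- M); intros x Hx.
  specialize (HM (- x)); rewrite atan_opp in HM; lra.
Qed.

Lemma RInt_inv_sq (a b : R) : RInt (fun x => 1 / (1 + x ^ 2)) a b = atan b - atan a.
Proof.
  apply RInt_derive_cont.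
  - intros x; replace (1 / (1 + x ^ 2)) with (/ (1 + x²)).
    + apply is_derive_atan.
    + unfold Rsqr; field; nra.
  - intros x; apply (ex_derive_continuous (V := R_NormedModule)); auto_derive; nra.
Qed.

Lemma cont_inv_sq (x : R) : continuous (fun x => 1 / (1 + x ^ 2)) x.
Proof. apply (ex_derive_continuous (V := R_NormedModule)); auto_derive; nra. Qed.

Lemma RInt_dominated (f : R -> R) (C a b : R) :
  (forall x, continuous f x) -> (forall x, Rabs (f x) <= C / (1 + x ^ 2)) ->
  Rabs (RInt f a b) <= C * Rabs (atan b - atan a).
Proof.
  intros Hc Hb.
  assert (main : forall a b, a <= b -> Rabs (RInt f a b) <= C * (atan b - atan a)).
  { clear a b; intros a b Hab.
    rewrite <- RInt_inv_sq, <- RInt_mult_l by apply cont_inv_sq.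
    apply Rle_trans with (RInt (fun x => Rabs (f x)) a b).
    - apply abs_RInt_le; [easy | now apply ex_RInt_cont].
    - apply RInt_le; [easy | | |].
      + apply ex_RInt_cont; intros; cont.
      + apply ex_RInt_cont; intros; apply (cont_mult (fun _ => C)); [apply cont_const | apply cont_inv_sq].
      + intros x _; specialize (Hb x); unfold Rdiv in *; lra. }
  (* At 0 the domination reads [Rabs (f 0) <= C]. *)
  assert (C0 : 0 <= C).
  { specialize (Hb 0); pose proof (Rabs_pos (f 0)); unfold Rdiv in Hb; simpl in Hb.
    replace (1 + 0 * (0 * 1)) with 1 in Hb by ring; lra. }
  destruct (Rle_dec a b) as [H|H].
  - eapply Rle_trans; [now apply main | apply Rmult_le_compat_l; [easy | apply Rle_abs]].
  - assert (Hba : b <= a) by lra.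
    rewrite (RInt_swap_opp f b a), Rabs_Ropp, Rabs_minus_sym by easy.
    eapply Rle_trans; [now apply main | apply Rmult_le_compat_l; [easy | apply Rle_abs]].
Qed.

(** [is_RInt_gen] speaks of a relation between endpoints and values; continuity makes [RInt] the
    witness for every pair of endpoints. *)
Lemma is_RInt_gen_cont (f : R -> R) (Fa Fb : (R -> Prop) -> Prop)
    {FFa : Filter Fa} {FFb : Filter Fb} (l : R) :
  (forall x, continuous f x) ->
  filterlim (fun ab => RInt f (fst ab) (snd ab)) (filter_prod Fa Fb) (locally l) ->
  is_RInt_gen f Fa Fb l.
Proof.
  intros Hc H P HP; apply H in HP; revert HP; unfold filtermap, filtermapi.
  apply filter_imp; intros ab Hab; exists (RInt f (fst ab) (snd ab)); split; [|easy].
  apply (RInt_correct (V := R_CompleteNormedModule)), ex_RInt_cont, Hc.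
Qed.

(** Cauchy criterion: integrals over two wide intervals differ by two end pieces, each at most [C]
    times a small increment of [atan]. *)
Lemma integrable_filterlim (f : R -> R) :
  integrable f ->
  filterlim (fun ab => RInt f (fst ab) (snd ab))
    (filter_prod (Rbar_locally m_infty) (Rbar_locally p_infty)) (locally (integral f)).
Proof.
  intros [Hc [C Hb]].
  assert (E : exists l, filterlim (fun ab => RInt f (fst ab) (snd ab))
    (filter_prod (Rbar_locally m_infty) (Rbar_locally p_infty)) (locally l)).
  { apply (filterlim_locally_cauchy (U := R_CompleteSpace)); intros eps.
    assert (C0 : 0 <= C).
    { specialize (Hb 0); pose proof (Rabs_pos (f 0)); unfold Rdiv in Hb; simpl in Hb.
      replace (1 + 0 * (0 * 1)) with 1 in Hb by ring; lra. }
    assert (Hd : 0 < eps / (2 * (C + 1))) by (apply Rdiv_lt_0_compat; [apply eps | lra]).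
    destruct (atan_near_half_PI (mkposreal _ Hd)) as [M1 H1].
    destruct (atan_near_minus_half_PI (mkposreal _ Hd)) as [M2 H2]; simpl in H1, H2.
    exists (fun ab => fst ab < M2 /\ M1 < snd ab); split.
    - apply Filter_prod with (Q := fun a => a < M2) (R := fun b => M1 < b).
      + now exists M2.
      + now exists M1.
      + now intros.
    - intros [a b] [a' b'] [Ha Hb1] [Ha' Hb']; simpl in *.
      change (Rabs (RInt f a' b' - RInt f a b) < eps).
      rewrite (RInt_split f a' a b'), (RInt_split f a b b') by easy.
      replace (RInt f a' a + (RInt f a b + RInt f b b') - RInt f a b)
        with (RInt f a' a + RInt f b b') by ring.
      eapply Rle_lt_trans; [apply Rabs_triang |].
      pose proof (RInt_dominated f C a' a Hc Hb); pose proof (RInt_dominated f C b b' Hc Hb).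
      pose proof (H1 _ Hb1); pose proof (H1 _ Hb'); pose proof (H2 _ Ha); pose proof (H2 _ Ha').
      pose proof (atan_bound a); pose proof (atan_bound a'); pose proof (atan_bound b);
        pose proof (atan_bound b').
      set (d := eps / (2 * (C + 1))) in *.
      assert (Rabs (atan a - atan a') < d) by (apply Rabs_def1; lra).
      assert (Rabs (atan b' - atan b) < d) by (apply Rabs_def1; lra).
      assert (Hed : pos eps = 2 * (C + 1) * d) by (unfold d; field; lra).
      nra. }
  destruct E as [l El].
  assert (El' := is_RInt_gen_cont f _ _ l Hc El).
  apply (is_RInt_gen_unique (V := R_CompleteNormedModule) f l) in El'.
  unfold integral; now rewrite El'.
Qed.

Lemma filterlim_opp_infty :
  filterlim Ropp (Rbar_locally p_infty) (Rbar_locally m_infty).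
Proof. apply (filterlim_Rbar_opp p_infty). Qed.

Lemma integral_lim (f : R -> R) :
  integrable f ->
  filterlim (fun B => RInt f (- B) B) (Rbar_locally p_infty) (locally (integral f)).
Proof.
  intros Hf.
  apply (filterlim_comp _ _ _ (fun B => (- B, B)) (fun ab => RInt f (fst ab) (snd ab))
    _ (filter_prod (Rbar_locally m_infty) (Rbar_locally p_infty))).
  - apply filterlim_pair; [apply filterlim_opp_infty | apply filterlim_id].
  - now apply integrable_filterlim.
Qed.

(** Since convergence is already known, symmetric intervals are enough to identify the value. *)
Lemma integral_eq_lim (f : R -> R) (l : R) :
  integrable f ->
  filterlim (fun B => RInt f (- B) B) (Rbar_locally p_infty) (locally l) -> integral f = l.
Proof.
  intros Hf H; apply integral_lim in Hf.
  apply (filterlim_locally_unique (F := Rbar_locally p_infty) (K := R_AbsRing)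
    (V := R_NormedModule)) with (1 := Hf) (2 := H).
Qed.

Lemma integral_ext (f g : R -> R) : (forall x, f x = g x) -> integral f = integral g.
Proof. intros H; f_equal; now apply functional_extensionality. Qed.

Lemma integrable_ext (f g : R -> R) : (forall x, f x = g x) -> integrable f -> integrable g.
Proof. intros H; now replace g with f by now apply functional_extensionality. Qed.

Lemma integrable_plus (f g : R -> R) :
  integrable f -> integrable g -> integrable (fun x => f x + g x).
Proof.
  intros [Hf [C HC]] [Hg [D HD]]; split; [intros; cont |].
  exists (C + D); intros x; specialize (HC x); specialize (HD x).
  eapply Rle_trans; [apply Rabs_triang |]; unfold Rdiv in *; lra.
Qed.

Lemma integrable_scal (c : R) (f : R -> R) : integrable f -> integrable (fun x => c * f x).
Proof.
  intros [Hf [C HC]]; split; [intros; cont |].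
  exists (Rabs c * C); intros x; specialize (HC x); rewrite Rabs_mult.
  unfold Rdiv in *; rewrite Rmult_assoc; apply Rmult_le_compat_l; [apply Rabs_pos | easy].
Qed.

Lemma integrable_minus (f g : R -> R) :
  integrable f -> integrable g -> integrable (fun x => f x - g x).
Proof.
  intros Hf Hg; apply (integrable_ext (fun x => f x + (-1) * g x)); [intros; ring |].
  now apply integrable_plus; [| apply integrable_scal].
Qed.

Ltac integ :=
  repeat first [ assumption | lazymatch goal with
  | |- integrable (fun x => @?f x + @?g x) => apply (integrable_plus f g)
  | |- integrable (fun x => @?f x - @?g x) => apply (integrable_minus f g)
  | |- integrable (fun x => ?c * @?f x) => apply (integrable_scal c f)
  end ].

Lemma integrable_reflect (f : R -> R) : integrable f -> integrable (fun x => f (- x)).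
Proof.
  intros [Hf [C HC]]; split.
  - intros x; apply (cont_comp (fun x => - x)); [cont | easy].
  - exists C; intros x; specialize (HC (- x)); now replace ((- x) ^ 2) with (x ^ 2) in HC by ring.
Qed.

Lemma integral_plus (f g : R -> R) :
  integrable f -> integrable g -> integral (fun x => f x + g x) = integral f + integral g.
Proof.
  intros Hf Hg; apply integral_eq_lim; [now apply integrable_plus |].
  apply (filterlim_ext (fun B => RInt f (- B) B + RInt g (- B) B)).
  - intros B; symmetry; apply RInt_sum; [apply Hf | apply Hg].
  - apply (filterlim_comp_2 (G := locally (integral f)) (H := locally (integral g)) _ _ Rplus);
      [now apply integral_lim | now apply integral_lim |].
    apply (filterlim_plus (K := R_AbsRing) (V := R_NormedModule) (integral f) (integral g)).
Qed.

Lemma integral_scal (c : R) (f : R -> R) :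
  integrable f -> integral (fun x => c * f x) = c * integral f.
Proof.
  intros Hf; apply integral_eq_lim; [now apply integrable_scal |].
  apply (filterlim_ext (fun B => c * RInt f (- B) B)).
  - intros B; symmetry; apply RInt_mult_l, Hf.
  - apply (is_lim_scal_l (fun B => RInt f (- B) B) c p_infty (integral f)).
    now apply integral_lim.
Qed.

Lemma integral_minus (f g : R -> R) :
  integrable f -> integrable g -> integral (fun x => f x - g x) = integral f - integral g.
Proof.
  intros Hf Hg; rewrite (integral_ext _ (fun x => f x + (-1) * g x)) by (intros; ring).
  rewrite integral_plus, integral_scal by (try apply integrable_scal; easy); ring.
Qed.

Lemma RInt_nonneg (f : R -> R) (a b : R) :
  a <= b -> (forall x, continuous f x) -> (forall x, 0 <= f x) -> 0 <= RInt f a b.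
Proof.
  intros Hab Hc H.
  replace 0 with (RInt (fun _ => 0) a b)
    by (rewrite RInt_const; unfold scal; simpl; unfold mult; simpl; ring).
  apply RInt_le; [easy | apply ex_RInt_const | now apply ex_RInt_cont | easy].
Qed.

Lemma RInt_le_cont (f g : R -> R) (a b : R) :
  a <= b -> (forall x, continuous f x) -> (forall x, continuous g x) ->
  (forall x, f x <= g x) -> RInt f a b <= RInt g a b.
Proof. intros; apply RInt_le; auto; now apply ex_RInt_cont. Qed.

Lemma RInt_le_integral (f : R -> R) (a b : R) :
  a <= b -> integrable f -> (forall x, 0 <= f x) -> RInt f a b <= integral f.
Proof.
  intros Hab Hf H.
  apply (filterlim_le (F := Rbar_locally p_infty) (fun _ => RInt f a b)
    (fun B => RInt f (- B) B) (RInt f a b) (integral f)).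
  - exists (Rmax (Rabs a) (Rabs b)); intros B HB.
    assert (Rabs a < B /\ Rabs b < B) as [H1 H2]
      by (pose proof (Rmax_l (Rabs a) (Rabs b)); pose proof (Rmax_r (Rabs a) (Rabs b)); lra).
    apply Rabs_def2 in H1; apply Rabs_def2 in H2.
    rewrite (RInt_split f (- B) a B), (RInt_split f a b B) by apply Hf.
    pose proof (RInt_nonneg f (- B) a ltac:(lra) ltac:(apply Hf) H).
    pose proof (RInt_nonneg f b B ltac:(lra) ltac:(apply Hf) H); lra.
  - apply filterlim_const.
  - now apply integral_lim.
Qed.

Lemma integral_ge_0 (f : R -> R) : integrable f -> (forall x, 0 <= f x) -> 0 <= integral f.
Proof.
  intros Hf H; eapply Rle_trans; [| apply (RInt_le_integral f 0 0); auto; lra].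
  apply RInt_nonneg; [lra | apply Hf | easy].
Qed.

Lemma integral_le (f g : R -> R) :
  integrable f -> integrable g -> (forall x, f x <= g x) -> integral f <= integral g.
Proof.
  intros Hf Hg H; assert (0 <= integral (fun x => g x - f x)).
  { apply integral_ge_0; [now apply integrable_minus | intros x; specialize (H x); lra]. }
  rewrite integral_minus in H0 by easy; lra.
Qed.

Lemma integral_gt_0 (f : R -> R) (x0 : R) :
  integrable f -> (forall x, 0 <= f x) -> 0 < f x0 -> 0 < integral f.
Proof.
  intros Hf H H0; pose proof (proj1 Hf x0) as Hc.
  apply filterlim_locally with (eps := mkposreal _ H0) in Hc; destruct Hc as [d Hd].
  pose proof (cond_pos d).
  (* On this interval [f] differs from [f x0] by less than [f x0], hence is positive. *)
  eapply Rlt_le_trans; [| apply (RInt_le_integral f x0 (x0 + d / 2)); auto; lra].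
  apply RInt_gt_0; [lra | | intros; apply Hf].
  intros x Hx; specialize (Hd x); assert (B : ball x0 d x).
  { change (Rabs (x - x0) < d); rewrite Rabs_pos_eq; lra. }
  apply Hd in B; change (Rabs (f x - f x0) < f x0) in B; apply Rabs_def2 in B; lra.
Qed.

Lemma integral_lt (f g : R -> R) (x0 : R) :
  integrable f -> integrable g -> (forall x, f x <= g x) -> f x0 < g x0 ->
  integral f < integral g.
Proof.
  intros Hf Hg H H0; assert (0 < integral (fun x => g x - f x)).
  { apply (integral_gt_0 _ x0); [now apply integrable_minus | | lra].
    intros x; specialize (H x); lra. }
  rewrite integral_minus in H1 by easy; lra.
Qed.

Lemma integral_Rabs_le (f g : R -> R) :
  integrable f -> integrable g -> (forall x, Rabs (f x) <= g x) -> Rabs (integral f) <= integral g.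
Proof.
  intros Hf Hg H; apply Rabs_le; split.
  - replace (- integral g) with ((-1) * integral g) by ring; rewrite <- integral_scal by easy.
    apply integral_le; [now apply integrable_scal | easy |].
    intros x; specialize (H x); apply Rabs_le_between in H; lra.
  - apply integral_le; try easy; intros x; specialize (H x); apply Rabs_le_between in H; lra.
Qed.

Lemma integral_reflect (f : R -> R) :
  integrable f -> integral (fun x => f (- x)) = integral f.
Proof.
  intros Hf; apply integral_eq_lim; [now apply integrable_reflect |].
  apply (filterlim_ext (fun B => RInt f (- B) B)); [| now apply integral_lim].
  intros B; rewrite RInt_reflect by apply Hf; now rewrite Ropp_involutive.
Qed.

Lemma integral_derive (F f : R -> R) (la lb : R) :
  integrable f -> (forall x, is_derive F x (f x)) ->
  filterlim F (Rbar_locally m_infty) (locally la) ->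
  filterlim F (Rbar_locally p_infty) (locally lb) -> integral f = lb - la.
Proof.
  intros Hf HF Ha Hb; apply integral_eq_lim; [easy |].
  apply (filterlim_ext (fun B => F B + - F (- B))).
  - intros B; rewrite (RInt_derive_cont F f) by (try easy; apply Hf); ring.
  - apply (filterlim_comp_2 (G := locally lb) (H := locally (- la)) F (fun B => - F (- B)) Rplus).
    + easy.
    + apply (filterlim_comp _ _ _ (fun B => F (- B)) Ropp _ (locally la)).
      * apply (filterlim_comp _ _ _ Ropp F _ (Rbar_locally m_infty)); [apply filterlim_opp_infty | easy].
      * apply (filterlim_opp (K := R_AbsRing) (V := R_NormedModule) la).
    + apply (filterlim_plus (K := R_AbsRing) (V := R_NormedModule) lb (- la)).
Qed.

Lemma smooth_cont (f : R -> R) (x : R) : ex_derive f x -> continuous f x.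
Proof. apply (ex_derive_continuous (V := R_NormedModule)). Qed.

Lemma exp_le_compat (x y : R) : x <= y -> exp x <= exp y.
Proof. intros [H | ->]; [left; now apply exp_increasing | lra]. Qed.

(** * The normal distribution *)

Definition gauss_int (x : R) : R := RInt (fun t => exp (- t ^ 2 / 2)) 0 x.

Lemma gauss_cont (x : R) : continuous (fun t => exp (- t ^ 2 / 2)) x.
Proof. cont. Qed.

Lemma is_derive_gauss_int (x : R) : is_derive gauss_int x (exp (- x ^ 2 / 2)).
Proof.
  apply (is_derive_RInt (V := R_NormedModule) (fun t => exp (- t ^ 2 / 2)) gauss_int 0).
  - apply filter_forall; intros y.
    apply (RInt_correct (V := R_CompleteNormedModule)), ex_RInt_cont, gauss_cont.
  - apply gauss_cont.
Qed.

(** Companion of [gauss_int] in the classical evaluation of the Gaussian integral by differentiation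
    under the integral sign. *)
Definition gauss_aux (x : R) : R :=
  RInt (fun t => exp (- x ^ 2 * (1 + t ^ 2) / 2) / (1 + t ^ 2)) 0 1.

Lemma gauss_aux_cont (x t : R) :
  continuous (fun t => exp (- x ^ 2 * (1 + t ^ 2) / 2) / (1 + t ^ 2)) t.
Proof. apply smooth_cont; auto_derive; nra. Qed.

Lemma is_derive_gauss_aux (x : R) :
  is_derive gauss_aux x (- exp (- x ^ 2 / 2) * gauss_int x).
Proof.
  assert (D : forall u t, is_derive
    (fun z => exp (- z ^ 2 * (1 + t ^ 2) / 2) / (1 + t ^ 2)) u
    (- u * exp (- u ^ 2 * (1 + t ^ 2) / 2))).
  { intros u t; auto_derive; [nra |].
    replace (- (u * (u * 1)) * (1 + t * (t * 1)) * / 2) with (- u ^ 2 * (1 + t ^ 2) / 2)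
      by (unfold Rdiv; ring).
    field; nra. }
  assert (E : RInt (fun t => Derive
      (fun z => exp (- z ^ 2 * (1 + t ^ 2) / 2) / (1 + t ^ 2)) x) 0 1 =
      - exp (- x ^ 2 / 2) * gauss_int x).
  { rewrite (RInt_ext _ (fun t => - exp (- x ^ 2 / 2) * (x * exp (- (x * t + 0) ^ 2 / 2)))).
    - rewrite RInt_mult_l, RInt_mult_l.
      + rewrite (RInt_affine (fun t => exp (- t ^ 2 / 2))) by apply gauss_cont.
        replace (x * 0 + 0) with 0 by ring; replace (x * 1 + 0) with x by ring; reflexivity.
      + intros; cont.
      + intros; cont.
    - intros t _.
      eqR; transitivity (- x * exp (- x ^ 2 * (1 + t ^ 2) / 2)); [apply is_derive_unique, D |].
      (* The exponential splits into a factor free of [t] and the Gaussian at [x * t]; the [+ 0]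
         fits the substitution rule [RInt_affine]. *)
      replace (- x ^ 2 * (1 + t ^ 2) / 2) with (- x ^ 2 / 2 + - (x * t + 0) ^ 2 / 2) by field.
      rewrite exp_plus; ring. }
  rewrite <- E.
  apply (is_derive_RInt_param
    (fun z t => exp (- z ^ 2 * (1 + t ^ 2) / 2) / (1 + t ^ 2)) 0 1 x).
  - apply filter_forall; intros u t _; eexists; apply D.
  - intros t _.
    apply (continuity_2d_pt_ext (fun u v => - u * exp (- u ^ 2 * (1 + v ^ 2) / 2))).
    + intros u v; symmetry; apply is_derive_unique, D.
    + apply continuity_2d_pt_mult;
        [apply continuity_2d_pt_opp, continuity_2d_pt_id1 |].
      apply (continuity_1d_2d_pt_comp exp);
        [apply derivable_continuous_pt, derivable_pt_exp |].
      apply (continuity_2d_pt_ext (fun u v => - (u * u) * (1 + v * v) * / 2));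
        [intros; unfold Rdiv; ring |].
      repeat first [ apply continuity_2d_pt_mult | apply continuity_2d_pt_opp
        | apply continuity_2d_pt_plus | apply continuity_2d_pt_id1
        | apply continuity_2d_pt_id2 | apply continuity_2d_pt_const ].
  - apply filter_forall; intros u; apply ex_RInt_cont, gauss_aux_cont.
Qed.

(** The derivatives cancel, and at 0 the left side is [2 * atan 1]. As [gauss_aux] vanishes at
    infinity, this gives the limit of [gauss_int]. *)
Lemma gauss_identity (x : R) : gauss_int x ^ 2 + 2 * gauss_aux x = PI / 2.
Proof.
  set (h := fun x => gauss_int x ^ 2 + 2 * gauss_aux x).
  assert (D : forall y, is_derive h y 0).
  { intros y; unfold h.
    replace 0 with (2 * (exp (- y ^ 2 / 2) * gauss_int y) +
      2 * (- exp (- y ^ 2 / 2) * gauss_int y)) by ring.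
    apply (is_derive_plus (V := R_NormedModule)).
    - pose proof (is_derive_gauss_int y).
      auto_derive; [now exists (exp (- y ^ 2 / 2)) |].
      replace (Derive _ y) with (exp (- y ^ 2 / 2)) by (symmetry; now apply is_derive_unique).
      ring.
    - apply (is_derive_scal gauss_aux), is_derive_gauss_aux. }
  assert (H0 : h 0 = PI / 2).
  { unfold h, gauss_int, gauss_aux.
    assert (Z : RInt (fun t => exp (- t ^ 2 / 2)) 0 0 = 0)
      by apply (RInt_point (V := R_CompleteNormedModule)).
    rewrite Z, (RInt_ext _ (fun t => 1 / (1 + t ^ 2))).
    - rewrite RInt_inv_sq, atan_0, atan_1; field.
    - intros t _; replace (- 0 ^ 2 * (1 + t ^ 2) / 2) with 0 by field; now rewrite exp_0. }
  change (h x = PI / 2); rewrite <- H0.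
  destruct (MVT_gen h 0 x (fun _ => 0)) as [c [_ Hc]].
  - intros; apply D.
  - intros y _; apply continuity_pt_filterlim, smooth_cont; now exists 0.
  - lra.
Qed.

Lemma exp_neg_le_inv (y : R) : 0 <= y -> exp (- y) <= / (1 + y).
Proof.
  intros Hy; rewrite exp_Ropp; apply Rinv_le_contravar; [lra |].
  destruct (Req_dec y 0) as [-> | H]; [rewrite exp_0; lra |].
  left; apply exp_ineq1; lra.
Qed.

Lemma gauss_aux_bounds (x : R) : 0 <= gauss_aux x <= / (1 + x ^ 2 / 2).
Proof.
  assert (B : forall t, 0 <= exp (- x ^ 2 * (1 + t ^ 2) / 2) / (1 + t ^ 2) <= / (1 + x ^ 2 / 2)).
  { intros t; assert (Ht := pow2_ge_0 t); assert (Hx := pow2_ge_0 x); split.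
    - apply Rle_mult_inv_pos; [left; apply exp_pos | lra].
    - apply Rle_trans with (exp (- (x ^ 2 / 2)) * 1).
      + apply Rmult_le_compat; [left; apply exp_pos | left; apply Rinv_0_lt_compat; lra | |].
        * apply exp_le_compat; nra.
        * rewrite <- Rinv_1; apply Rinv_le_contravar; lra.
      + rewrite Rmult_1_r; apply exp_neg_le_inv; lra. }
  split.
  - apply RInt_nonneg; [lra | apply gauss_aux_cont | intros; apply B].
  - replace (/ (1 + x ^ 2 / 2)) with (RInt (fun _ => / (1 + x ^ 2 / 2)) 0 1).
    + apply RInt_le_cont; [lra | apply gauss_aux_cont | intros; cont | intros; apply B].
    + rewrite RInt_const; eqR; unfold scal; simpl; unfold mult; simpl; ring.
Qed.

Lemma filterlim_inv_infty : filterlim (fun x => / x) (Rbar_locally p_infty) (locally 0).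
Proof.
  apply (is_lim_inv (fun x => x) p_infty p_infty); [apply is_lim_id | discriminate].
Qed.

Lemma gauss_int_lim : filterlim gauss_int (Rbar_locally p_infty) (locally (sqrt (PI / 2))).
Proof.
  apply (filterlim_ext_loc (fun x => sqrt (PI / 2 - 2 * gauss_aux x))).
  - exists 0; intros x Hx; rewrite <- (gauss_identity x).
    replace (gauss_int x ^ 2 + 2 * gauss_aux x - 2 * gauss_aux x) with (gauss_int x ^ 2) by ring.
    apply sqrt_pow2, RInt_nonneg; [lra | apply gauss_cont | intros; left; apply exp_pos].
  - apply (filterlim_comp _ _ _ (fun x => PI / 2 - 2 * gauss_aux x) sqrt _ (locally (PI / 2))).
    + assert (L : is_lim gauss_aux p_infty 0).
      { apply (is_lim_le_le_loc (fun _ => 0) (fun x => / x)).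
        - exists 1; intros x Hx; destruct (gauss_aux_bounds x); split; [easy |].
          eapply Rle_trans; [eassumption | apply Rinv_le_contravar; nra].
        - apply is_lim_const.
        - apply filterlim_inv_infty. }
      assert (M : is_lim (fun x => PI / 2 - 2 * gauss_aux x) p_infty (PI / 2 - 2 * 0)).
      { apply (is_lim_minus' (fun _ => PI / 2) (fun x => 2 * gauss_aux x) p_infty);
          [apply is_lim_const | now apply (is_lim_scal_l gauss_aux 2 p_infty 0)]. }
      now replace (PI / 2 - 2 * 0) with (PI / 2) in M by ring.
    + apply continuity_pt_filterlim, continuity_pt_sqrt; pose proof PI_RGT_0; lra.
Qed.

Lemma sqrt_2PI_gt_1 : 1 < sqrt (2 * PI).
Proof. rewrite <- sqrt_1; apply sqrt_lt_1_alt; pose proof PI2_1; lra. Qed.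

Lemma phi_pos (x : R) : 0 < phi x.
Proof.
  apply Rdiv_lt_0_compat; [apply exp_pos | pose proof sqrt_2PI_gt_1; lra].
Qed.

Lemma phi_even (x : R) : phi (- x) = phi x.
Proof. unfold phi; now replace ((- x) ^ 2) with (x ^ 2) by ring. Qed.

Lemma is_derive_phi (x : R) : is_derive phi x (- x * phi x).
Proof.
  pose proof sqrt_2PI_gt_1; unfold phi; auto_derive; [easy |].
  replace (- (x * (x * 1)) * / 2) with (- x ^ 2 / 2) by (unfold Rdiv; ring); field; lra.
Qed.

Lemma phi_cont (x : R) : continuous phi x.
Proof. apply smooth_cont; eexists; apply is_derive_phi. Qed.

Lemma phi_le (x y : R) : x ^ 2 <= y ^ 2 -> phi y <= phi x.
Proof.
  intros H; apply Rmult_le_compat_r.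
  - left; apply Rinv_0_lt_compat; pose proof sqrt_2PI_gt_1; lra.
  - apply exp_le_compat; lra.
Qed.

(** Writing [exp (- x^2 / 2)] as the square of [exp (- x^2 / 4)] and bounding each factor by
    [4 / (4 + x^2)] produces the constant 16. *)
Lemma phi_decay (x : R) : (1 + x ^ 2) * phi x <= 16 / (1 + x ^ 2).
Proof.
  assert (Hx := pow2_ge_0 x).
  assert (H : phi x <= (/ (1 + x ^ 2 / 4)) ^ 2).
  { apply Rle_trans with (exp (- x ^ 2 / 2)).
    - unfold phi; rewrite <- (Rmult_1_r (exp _)) at 2.
      apply Rmult_le_compat_l; [left; apply exp_pos |].
      rewrite <- Rinv_1; apply Rinv_le_contravar; pose proof sqrt_2PI_gt_1; lra.
    - replace (- x ^ 2 / 2) with (- (x ^ 2 / 4) + - (x ^ 2 / 4)) by field.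
      rewrite exp_plus; pose proof (exp_neg_le_inv (x ^ 2 / 4) ltac:(lra)).
      pose proof (exp_pos (- (x ^ 2 / 4))).
      replace ((/ (1 + x ^ 2 / 4)) ^ 2) with (/ (1 + x ^ 2 / 4) * / (1 + x ^ 2 / 4)) by ring.
      apply Rmult_le_compat; lra. }
  apply Rle_trans with ((1 + x ^ 2) * (/ (1 + x ^ 2 / 4)) ^ 2);
    [apply Rmult_le_compat_l; [lra | easy] |].
  replace ((1 + x ^ 2) * (/ (1 + x ^ 2 / 4)) ^ 2) with
    ((16 / (1 + x ^ 2)) * ((1 + x ^ 2) / (4 + x ^ 2)) ^ 2) by (field; lra).
  rewrite <- (Rmult_1_r (16 / (1 + x ^ 2))) at 2; apply Rmult_le_compat_l.
  - apply Rle_mult_inv_pos; lra.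
  - assert (0 <= (1 + x ^ 2) / (4 + x ^ 2) <= 1).
    { split; [apply Rle_mult_inv_pos; lra |].
      apply Rmult_le_reg_r with (4 + x ^ 2); [lra |].
      unfold Rdiv; rewrite Rmult_assoc, Rinv_l; lra. }
    nra.
Qed.

Lemma integrable_phi_mult (h : R -> R) (C : R) :
  (forall x, continuous h x) -> (forall x, Rabs (h x) <= C * (1 + x ^ 2)) ->
  integrable (fun x => phi x * h x).
Proof.
  intros Hc Hb; split; [intros; apply (cont_mult phi h); [apply phi_cont | easy] |].
  exists (C * 16); intros x; specialize (Hb x).
  pose proof (phi_pos x); pose proof (phi_decay x); assert (Hx := pow2_ge_0 x).
  assert (HC : 0 <= C) by (pose proof (Rabs_pos (h x)); nra).
  rewrite Rabs_mult, (Rabs_pos_eq (phi x)) by lra.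
  apply Rle_trans with (C * ((1 + x ^ 2) * phi x)); [nra |].
  unfold Rdiv in *; rewrite Rmult_assoc; now apply Rmult_le_compat_l.
Qed.

Lemma integrable_phi : integrable phi.
Proof.
  apply (integrable_ext (fun x => phi x * 1)); [intros; ring |].
  apply (integrable_phi_mult _ 1); [intros; cont |].
  intros x; rewrite Rabs_R1; nra.
Qed.

Lemma RInt_phi_0_lim : filterlim (RInt phi 0) (Rbar_locally p_infty) (locally (1 / 2)).
Proof.
  pose proof sqrt_2PI_gt_1 as S.
  apply (filterlim_ext (fun x => / sqrt (2 * PI) * gauss_int x)).
  - intros x; unfold gauss_int; rewrite <- RInt_mult_l by apply gauss_cont.
    apply RInt_ext; intros; eqR; unfold phi, Rdiv; ring.
  - replace (1 / 2) with (/ sqrt (2 * PI) * sqrt (PI / 2)).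
    + apply (is_lim_scal_l gauss_int (/ sqrt (2 * PI)) p_infty (sqrt (PI / 2))), gauss_int_lim.
    + replace (2 * PI) with (2 ^ 2 * (PI / 2)) by field.
      pose proof PI_RGT_0; rewrite sqrt_mult, sqrt_pow2 by lra.
      assert (0 < sqrt (PI / 2)) by (apply sqrt_lt_R0; lra).
      field; lra.
Qed.

Lemma RInt_phi_0_opp (x : R) : RInt phi 0 (- x) = - RInt phi 0 x.
Proof.
  rewrite (RInt_swap_opp phi (- x) 0) by apply phi_cont; f_equal.
  pose proof (RInt_reflect phi 0 x phi_cont) as E; rewrite Ropp_0 in E; rewrite <- E.
  apply RInt_ext; intros; apply phi_even.
Qed.

Lemma RInt_phi_0_lim_minus :
  filterlim (RInt phi 0) (Rbar_locally m_infty) (locally (- (1 / 2))).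
Proof.
  apply (filterlim_ext (fun x => - RInt phi 0 (- x))).
  - intros x; rewrite RInt_phi_0_opp; ring.
  - apply (filterlim_comp _ _ _ (fun x => RInt phi 0 (- x)) Ropp _ (locally (1 / 2))).
    + apply (filterlim_comp _ _ _ Ropp (RInt phi 0) _ (Rbar_locally p_infty)).
      * apply (filterlim_Rbar_opp m_infty).
      * apply RInt_phi_0_lim.
    + apply (filterlim_opp (K := R_AbsRing) (V := R_NormedModule) (1 / 2)).
Qed.

Lemma Phi_eq (x : R) : Phi x = 1 / 2 + RInt phi 0 x.
Proof.
  apply (is_RInt_gen_unique (V := R_CompleteNormedModule)), is_RInt_gen_cont;
    [apply Rbar_locally_filter | apply at_point_filter | apply phi_cont |].
  apply (filterlim_ext_loc (fun ab => RInt phi 0 x + - RInt phi 0 (fst ab))).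
  (* [at_point x] is the principal filter at [x], so the upper endpoint may be taken equal to
     [x]. *)
  - apply Filter_prod with (Q := fun _ => True) (R := fun b => b = x).
    + apply filter_true.
    + reflexivity.
    + intros a b _ ->; simpl; rewrite (RInt_split phi 0 a x) by apply phi_cont; eqR; ring.
  - replace (1 / 2 + RInt phi 0 x) with (RInt phi 0 x + - - (1 / 2)) by ring.
    apply (filterlim_comp_2 (G := locally (RInt phi 0 x)) (H := locally (- - (1 / 2))) _ _ Rplus).
    + apply filterlim_const.
    + apply (filterlim_comp _ _ _ (fun ab : R * R => RInt phi 0 (fst ab)) Ropp _
        (locally (- (1 / 2)))).
      * apply (filterlim_comp _ _ _ fst (RInt phi 0) _ (Rbar_locally m_infty));
          [apply filterlim_fst | apply RInt_phi_0_lim_minus].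
      * apply (filterlim_opp (K := R_AbsRing) (V := R_NormedModule) (- (1 / 2))).
    + apply (filterlim_plus (K := R_AbsRing) (V := R_NormedModule) (RInt phi 0 x) (- - (1 / 2))).
Qed.

Lemma is_derive_Phi (x : R) : is_derive Phi x (phi x).
Proof.
  apply (is_derive_ext (fun y => 1 / 2 + RInt phi 0 y)); [intros; now rewrite Phi_eq |].
  replace (phi x) with (0 + phi x) by ring.
  apply (is_derive_plus (V := R_NormedModule) (fun _ => 1 / 2)).
  - apply (is_derive_const (V := R_NormedModule)).
  - apply (is_derive_RInt (V := R_NormedModule) phi _ 0).
    + apply filter_forall; intros y.
      apply (RInt_correct (V := R_CompleteNormedModule)), ex_RInt_cont, phi_cont.
    + apply phi_cont.
Qed.

Lemma Phi_cont (x : R) : continuous Phi x.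
Proof. apply smooth_cont; eexists; apply is_derive_Phi. Qed.

Lemma RInt_phi (a b : R) : RInt phi a b = Phi b - Phi a.
Proof. apply RInt_derive_cont; [apply is_derive_Phi | apply phi_cont]. Qed.

Lemma Phi_0 : Phi 0 = 1 / 2.
Proof.
  rewrite Phi_eq; assert (Z : RInt phi 0 0 = 0) by apply (RInt_point (V := R_CompleteNormedModule)).
  rewrite Z; ring.
Qed.

Lemma Phi_opp (x : R) : Phi (- x) = 1 - Phi x.
Proof. rewrite !Phi_eq, RInt_phi_0_opp; field. Qed.

Lemma Phi_incr (x y : R) : x < y -> Phi x < Phi y.
Proof.
  intros H; assert (0 < RInt phi x y).
  { apply RInt_gt_0; [easy | intros; apply phi_pos | intros; apply phi_cont]. }
  rewrite RInt_phi in H0; lra.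
Qed.

Lemma Phi_le (x y : R) : x <= y -> Phi x <= Phi y.
Proof. intros [H | ->]; [left; now apply Phi_incr | lra]. Qed.

Lemma Phi_lim_p : filterlim Phi (Rbar_locally p_infty) (locally 1).
Proof.
  apply (filterlim_ext (fun x => 1 / 2 + RInt phi 0 x)); [intros; now rewrite Phi_eq |].
  assert (L : is_lim (fun x => 1 / 2 + RInt phi 0 x) p_infty (1 / 2 + 1 / 2)).
  { apply (is_lim_plus' (fun _ => 1 / 2) (RInt phi 0) p_infty);
      [apply is_lim_const | apply RInt_phi_0_lim]. }
  now replace (1 / 2 + 1 / 2) with 1 in L by field.
Qed.

Lemma Phi_lim_m : filterlim Phi (Rbar_locally m_infty) (locally 0).
Proof.
  apply (filterlim_ext (fun x => 1 / 2 + RInt phi 0 x)); [intros; now rewrite Phi_eq |].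
  assert (L : is_lim (fun x => 1 / 2 + RInt phi 0 x) m_infty (1 / 2 + - (1 / 2))).
  { apply (is_lim_plus' (fun _ => 1 / 2) (RInt phi 0) m_infty);
      [apply is_lim_const | apply RInt_phi_0_lim_minus]. }
  now replace (1 / 2 + - (1 / 2)) with 0 in L by field.
Qed.

Lemma Phi_nonneg (x : R) : 0 <= Phi x.
Proof.
  apply (filterlim_le (F := Rbar_locally m_infty) Phi (fun _ => Phi x) 0 (Phi x)).
  - exists x; intros y Hy; apply Phi_le; lra.
  - apply Phi_lim_m.
  - apply filterlim_const.
Qed.

Lemma Phi_pos (x : R) : 0 < Phi x.
Proof. pose proof (Phi_nonneg (x - 1)); pose proof (Phi_incr (x - 1) x ltac:(lra)); lra. Qed.

Lemma Phi_lt_1 (x : R) : Phi x < 1.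
Proof. pose proof (Phi_pos (- x)); rewrite Phi_opp in H; lra. Qed.

Lemma integral_phi : integral phi = 1.
Proof.
  rewrite (integral_derive Phi phi 0 1); [ring | apply integrable_phi | apply is_derive_Phi
    | apply Phi_lim_m | apply Phi_lim_p].
Qed.

Lemma phi_lt_1 (x : R) : phi x < 1.
Proof.
  pose proof sqrt_2PI_gt_1; apply Rle_lt_trans with (phi 0).
  - apply phi_le; nra.
  - unfold phi; replace (- 0 ^ 2 / 2) with 0 by field; rewrite exp_0.
    apply Rmult_lt_reg_r with (sqrt (2 * PI)); [lra |].
    unfold Rdiv; rewrite Rmult_assoc, Rinv_l; lra.
Qed.

(** * Lipschitz and Taylor bounds for the normal density and cdf *)

Lemma mean_value (f df : R -> R) (a b : R) :
  (forall x, is_derive f x (df x)) ->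
  exists c, Rmin a b <= c <= Rmax a b /\ f b - f a = df c * (b - a).
Proof.
  intros H; apply (MVT_gen f a b df); intros x _; [apply H |].
  apply continuity_pt_filterlim, smooth_cont; eexists; apply H.
Qed.

(** This bounds the derivative of [phi]. After [exp_neg_le_inv] only [|x| <= 1 + x^2 / 2] remains, a
    consequence of [(|x| - 1)^2 >= 0]. *)
Lemma abs_mult_phi_le_1 (x : R) : Rabs x * phi x <= 1.
Proof.
  apply Rle_trans with (Rabs x * exp (- (x ^ 2 / 2))).
  - apply Rmult_le_compat_l; [apply Rabs_pos |].
    unfold phi; replace (- x ^ 2 / 2) with (- (x ^ 2 / 2)) by field.
    rewrite <- (Rmult_1_r (exp _)) at 2; apply Rmult_le_compat_l; [left; apply exp_pos |].
    rewrite <- Rinv_1; apply Rinv_le_contravar; pose proof sqrt_2PI_gt_1; lra.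
  - assert (Hx := pow2_ge_0 x).
    apply Rle_trans with (Rabs x * / (1 + x ^ 2 / 2)).
    + apply Rmult_le_compat_l; [apply Rabs_pos | apply exp_neg_le_inv; lra].
    + apply Rmult_le_reg_r with (1 + x ^ 2 / 2); [lra |].
      rewrite Rmult_assoc, Rinv_l by lra; rewrite <- (pow2_abs x).
      pose proof (pow2_ge_0 (Rabs x - 1)); nra.
Qed.

Lemma phi_lipschitz (x y : R) : Rabs (phi y - phi x) <= Rabs (y - x).
Proof.
  destruct (mean_value phi (fun x => - x * phi x) x y is_derive_phi) as [c [_ Hc]].
  rewrite Hc, Rabs_mult; rewrite <- (Rmult_1_l (Rabs (y - x))) at 2.
  apply Rmult_le_compat_r; [apply Rabs_pos |].
  rewrite Rabs_mult, Rabs_Ropp, (Rabs_pos_eq (phi c)) by (left; apply phi_pos).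
  apply abs_mult_phi_le_1.
Qed.

Lemma Phi_lipschitz (x y : R) : Rabs (Phi y - Phi x) <= Rabs (y - x).
Proof.
  destruct (mean_value Phi phi x y is_derive_Phi) as [c [_ Hc]].
  rewrite Hc, Rabs_mult; rewrite <- (Rmult_1_l (Rabs (y - x))) at 2.
  apply Rmult_le_compat_r; [apply Rabs_pos |].
  rewrite Rabs_pos_eq by (left; apply phi_pos); left; apply phi_lt_1.
Qed.

(** Mean value theorem followed by the Lipschitz bound on [phi]; the quadratic remainder is what
    later differentiates [gap] under the integral. *)
Lemma Phi_taylor (x y : R) : Rabs (Phi y - Phi x - (y - x) * phi x) <= (y - x) ^ 2.
Proof.
  destruct (mean_value Phi phi x y is_derive_Phi) as [c [Hc E]].
  replace (Phi y - Phi x - (y - x) * phi x) with ((phi c - phi x) * (y - x)) by (rewrite E; ring).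
  rewrite Rabs_mult, <- (pow2_abs (y - x)).
  apply Rle_trans with (Rabs (y - x) * Rabs (y - x)); [| simpl; lra].
  apply Rmult_le_compat_r; [apply Rabs_pos |].
  eapply Rle_trans; [apply phi_lipschitz |].
  unfold Rmin, Rmax in Hc; destruct (Rle_dec x y);
    [rewrite !Rabs_pos_eq by lra | rewrite !Rabs_left1 by lra]; lra.
Qed.

(** * Symmetric kernels on a square *)

Lemma continuity_2d_pt_section (k : R -> R -> R) (u v : R) :
  continuity_2d_pt k u v -> continuous (k u) v.
Proof.
  intros H; apply filterlim_locally; intros eps; destruct (H eps) as [d Hd].
  exists d; intros z Hz; apply Hd; [| apply Hz].
  rewrite Rminus_diag, Rabs_R0; apply cond_pos.
Qed.

(** Continuity of [k] is uniform along the compact segment from [(x, c)] to [(x, b)]. *)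
Lemma continuous_RInt_param (k : R -> R -> R) (c b x : R) :
  (forall u v, continuity_2d_pt k u v) -> continuous (fun u => RInt (k u) c b) x.
Proof.
  intros Hk.
  assert (Hc : forall u v, continuous (k u) v).
  { intros; now apply continuity_2d_pt_section. }
  assert (main : forall c b, c <= b -> continuous (fun u => RInt (k u) c b) x).
  { clear c b; intros c b Hcb; apply filterlim_locally; intros eps.
    assert (He : 0 < eps / (b - c + 1)) by (apply Rdiv_lt_0_compat; [apply eps | lra]).
    destruct (uniform_continuity_2d_1d' k c b x (fun t _ => Hk x t) (mkposreal _ He)) as [d Hd].
    exists d; intros y Hy; change (Rabs (y - x) < d) in Hy.
    change (Rabs (RInt (k y) c b - RInt (k x) c b) < eps).
    assert (E : RInt (fun t => k y t + (-1) * k x t) c b = RInt (k y) c b - RInt (k x) c b).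
    { rewrite RInt_sum, RInt_mult_l; [eqR; ring | apply Hc | apply Hc |].
      intros t; apply (cont_mult (fun _ => -1) (k x)); [cont | apply Hc]. }
    rewrite <- E; simpl in Hd; set (e := eps / (b - c + 1)) in *.
    apply Rle_lt_trans with ((b - c) * e).
    - apply abs_RInt_le_const; [easy | |].
      + apply ex_RInt_cont; intros t; apply (cont_plus (k y)); [apply Hc |].
        apply (cont_mult (fun _ => -1) (k x)); [cont | apply Hc].
      + intros t Ht; left; replace (k y t + -1 * k x t) with (k y t - k x t) by ring.
        assert (Hd0 := cond_pos d); apply Rabs_def2 in Hy.
        apply Hd; try lra; rewrite Rminus_diag, Rabs_R0; easy.
    - replace (pos eps) with ((b - c + 1) * e) by (unfold e; field; lra); nra. }
  destruct (Rle_dec c b) as [H | H]; [now apply main |].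
  apply (continuous_ext (fun u => - RInt (k u) b c)).
  - intros u; symmetry; apply RInt_swap_opp, Hc.
  - apply cont_opp, main; lra.
Qed.

Lemma is_derive_RInt_upper (f : R -> R) (c b : R) :
  (forall x, continuous f x) -> is_derive (fun b => RInt f c b) b (f b).
Proof.
  intros H; apply (is_derive_RInt (V := R_NormedModule) f _ c); [| apply H].
  apply filter_forall; intros y.
  now apply (RInt_correct (V := R_CompleteNormedModule)), ex_RInt_cont.
Qed.

(* Both sides have the same derivative in the corner [b] of the square. *)
Lemma RInt_square_symmetric (k : R -> R -> R) (h : R -> R) (c b : R) :
  c <= b -> (forall x y, continuity_2d_pt k x y) -> (forall x y, k x y = k y x) ->
  (forall m, c <= m -> h m = RInt (k m) c m) -> (forall m, continuous h m) ->
  RInt (fun x => RInt (k x) c b) c b = RInt (fun m => 2 * h m) c b.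
Proof.
  intros Hcb Hk Hs Hh Hhc.
  assert (Hc : forall u v, continuous (k u) v).
  { intros; now apply continuity_2d_pt_section. }
  set (D := fun b => RInt (fun x => RInt (k x) c b) c b + - RInt (fun m => 2 * h m) c b).
  assert (HD : forall b, is_derive D b (2 * RInt (k b) c b - 2 * h b)).
  { clear b Hcb; intros b; unfold D.
    (* Leibniz rule: moving the inner bound and moving the outer bound each contribute
       [RInt (k b) c b], the former after exchanging the arguments of [k]. *)
    replace (2 * RInt (k b) c b - 2 * h b) with
      ((RInt (fun t => Derive (fun u => RInt (k t) c u) b) c b + RInt (k b) c b * 1)
      + - (2 * h b)).
    - apply (is_derive_plus (V := R_NormedModule)).
      + assert (E : forall u v, Derive (fun z => RInt (k v) c z) u = k u v).
        { intros; rewrite Hs; now apply is_derive_unique, is_derive_RInt_upper. }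
        assert (E2 : forall u v, continuity_2d_pt
          (fun u v => Derive (fun z => RInt (k v) c z) u) u v).
        { intros; now apply (continuity_2d_pt_ext k). }
        apply (is_derive_RInt_param_bound_comp_aux3 (fun u t => RInt (k t) c u) c (fun b => b)).
        * apply filter_forall; intros; apply ex_RInt_cont; intros; now apply continuous_RInt_param.
        * exists (mkposreal 1 Rlt_0_1); apply filter_forall; intros; apply ex_RInt_cont; intros.
          now apply continuous_RInt_param.
        * apply (is_derive_id (K := R_AbsRing)).
        * exists (mkposreal 1 Rlt_0_1); apply filter_forall; intros u t _; eexists.
          now apply is_derive_RInt_upper.
        * intros; apply E2.
        * apply locally_2d_forall; intros; apply E2.
        * apply continuity_pt_filterlim; now apply continuous_RInt_param.
      + apply (is_derive_opp (V := R_NormedModule)), (is_derive_RInt_upper (fun m => 2 * h m)).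
        intros; cont.
    - rewrite (RInt_ext _ (k b)).
      + eqR; ring.
      + intros t _; rewrite <- Hs; now apply is_derive_unique, is_derive_RInt_upper. }
  (* The formula for [h] is only known to the right of [c], where the mean value point lies; the
     derivative of [D] is zero there. *)
  destruct (mean_value D _ c b HD) as [d [Hcd Hd]].
  rewrite Rmin_left, Rmax_right in Hcd by easy.
  rewrite <- Hh, Rminus_diag, Rmult_0_l in Hd by easy.
  assert (Z : forall f : R -> R, RInt f c c = 0)
    by (intros; apply (RInt_point (V := R_CompleteNormedModule))).
  unfold D in Hd; rewrite !Z in Hd; lra.
Qed.

(** * The expected acceptance probability as a one-dimensional integral *)

Definition damp (l m : R) : R := Rmin 1 (exp (- l * m - l ^ 2 / 2)).

Lemma acc_damp (l z1 z2 : R) : 0 < l -> acc l z1 z2 = damp l (Rmax z1 z2).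
Proof.
  intros Hl; unfold acc, damp; f_equal; unfold Rmax; destruct (Rle_dec z1 z2) as [H | H].
  - apply Rmin_right, exp_le_compat; nra.
  - apply Rmin_left, exp_le_compat; nra.
Qed.

Lemma damp_pos (l m : R) : 0 < damp l m.
Proof. apply Rmin_glb_lt; [lra | apply exp_pos]. Qed.

Lemma damp_le_1 (l m : R) : damp l m <= 1.
Proof. apply Rmin_l. Qed.

Lemma damp_cont (l m : R) : continuous (damp l) m.
Proof. unfold damp; cont. Qed.

Lemma damp_antitone (l x y : R) : 0 < l -> x <= y -> damp l y <= damp l x.
Proof.
  intros Hl H; apply Rle_min_compat_l, exp_le_compat; nra.
Qed.

Lemma damp_lipschitz (l x y : R) : 0 < l -> Rabs (damp l y - damp l x) <= l * Rabs (y - x).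
Proof.
  intros Hl.
  assert (main : forall x y, x <= y -> damp l x - damp l y <= l * (y - x)).
  { clear x y; intros x y Hxy.
    assert (Hp : 0 <= l * (y - x)) by (apply Rmult_le_pos; lra).
    (* This is [1 - s <= exp (- s)] with [s = l * (y - x)]. When [1 - s] is negative the left side
       is at most 0, so that case is treated apart. *)
    assert (H : damp l x * (1 - l * (y - x)) <= damp l y).
    { pose proof (damp_pos l x); pose proof (damp_le_1 l x).
      apply Rmin_glb; [nra |].
      apply Rle_trans with (exp (- l * x - l ^ 2 / 2) * exp (- (l * (y - x)))).
      - destruct (Rle_dec 0 (1 - l * (y - x))).
        + apply Rmult_le_compat; [lra | easy | apply Rmin_r |].
          destruct (Req_dec (l * (y - x)) 0) as [E | E].
          * rewrite E, Ropp_0, exp_0; lra.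
          * left; pose proof (exp_ineq1 (- (l * (y - x))) ltac:(lra)); lra.
        + apply Rle_trans with 0; [nra |].
          left; apply Rmult_lt_0_compat; apply exp_pos.
      - rewrite <- exp_plus; apply exp_le_compat; lra. }
    pose proof (damp_le_1 l x); pose proof (damp_pos l x); nra. }
  destruct (Rle_dec x y) as [H | H].
  - pose proof (damp_antitone l x y Hl H).
    rewrite Rabs_left1, Rabs_pos_eq by lra; specialize (main x y H); lra.
  - assert (H' : y <= x) by lra; pose proof (damp_antitone l y x Hl H').
    rewrite Rabs_pos_eq, Rabs_left1 by lra; specialize (main y x H'); lra.
Qed.

Lemma integrable_phi_bounded (h : R -> R) :
  (forall x, continuous h x) -> (forall x, 0 <= h x <= 1) -> integrable (fun x => phi x * h x).
Proof.
  intros Hc Hb; apply (integrable_phi_mult _ 1); [easy |].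
  intros x; specialize (Hb x); rewrite Rabs_pos_eq by lra; nra.
Qed.

Lemma integral_phi_bounded (h : R -> R) :
  (forall x, continuous h x) -> (forall x, 0 <= h x <= 1) ->
  0 <= integral (fun x => phi x * h x) <= 1.
Proof.
  intros Hc Hb; pose proof (integrable_phi_bounded h Hc Hb) as Hi; split.
  - apply integral_ge_0; [easy |]; intros x; pose proof (phi_pos x); specialize (Hb x); nra.
  - rewrite <- integral_phi; apply integral_le; [easy | apply integrable_phi |].
    intros x; pose proof (phi_pos x); specialize (Hb x); nra.
Qed.

(** The upper bound is the lower bound applied to [phi * (1 - h)], whose integral is 1 minus that of
    [phi * h]. *)
Lemma integral_phi_truncated (h : R -> R) (A Y : R) :
  A <= Y -> (forall x, continuous h x) -> (forall x, 0 <= h x <= 1) ->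
  RInt (fun x => phi x * h x) A Y <= integral (fun x => phi x * h x)
    <= RInt (fun x => phi x * h x) A Y + Phi A + Phi (- Y).
Proof.
  intros HAY Hc Hb; pose proof (integrable_phi_bounded h Hc Hb) as Hi; split.
  - apply RInt_le_integral; [easy | easy |].
    intros x; pose proof (phi_pos x); specialize (Hb x); nra.
  - assert (Hm : integrable (fun x => phi x - phi x * h x))
      by (apply integrable_minus; [apply integrable_phi | easy]).
    assert (H : RInt (fun x => phi x + (-1) * (phi x * h x)) A Y <=
      integral (fun x => phi x - phi x * h x)).
    { rewrite (RInt_ext _ (fun x => phi x - phi x * h x)) by (intros; eqR; ring).
      apply RInt_le_integral; [easy | easy |].
      intros x; pose proof (phi_pos x); specialize (Hb x); nra. }
    assert (Hp : forall x, continuous (fun x => phi x * h x) x) by apply Hi.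
    rewrite integral_minus, integral_phi in H by (try apply integrable_phi; easy).
    rewrite RInt_sum, RInt_mult_l, RInt_phi in H;
      [| easy | apply phi_cont | intros; apply (cont_mult (fun _ => -1)); [cont | apply Hp]].
    rewrite Phi_opp; lra.
Qed.

(** The conditional expectation of the acceptance function given [Z1 = x]. *)
Definition inner (l rho x : R) : R :=
  integral (fun y => phi y * damp l (Rmax x (rho * x + sqrt (1 - rho ^ 2) * y))).

Lemma Rmax_lipschitz (rho x x' c : R) : Rabs rho <= 1 ->
  Rabs (Rmax x' (rho * x' + c) - Rmax x (rho * x + c)) <= Rabs (x' - x).
Proof.
  intros H; apply Rabs_le_between in H.
  assert (L : Rabs ((rho * x' + c) - (rho * x + c)) <= Rabs (x' - x)).
  { replace (rho * x' + c - (rho * x + c)) with (rho * (x' - x)) by ring.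
    rewrite Rabs_mult, <- (Rmult_1_l (Rabs (x' - x))) at 1.
    rewrite Rmult_1_l; apply Rabs_le_between in H; pose proof (Rabs_pos (x' - x)); nra. }
  revert L; generalize (rho * x' + c) (rho * x + c); intros p q L.
  unfold Rmax; destruct (Rle_dec x' p), (Rle_dec x q); try easy; try lra;
    unfold Rabs in *; destruct (Rcase_abs (p - q)), (Rcase_abs (x' - x));
    repeat destruct (Rcase_abs _); lra.
Qed.

Lemma damp_max_cont (l rho x y : R) :
  continuous (fun y => damp l (Rmax x (rho * x + sqrt (1 - rho ^ 2) * y))) y.
Proof.
  apply (cont_comp (fun y => Rmax x (rho * x + sqrt (1 - rho ^ 2) * y)));
    [cont | apply damp_cont].
Qed.

Lemma damp_bounds (l m : R) : 0 <= damp l m <= 1.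
Proof. split; [left; apply damp_pos | apply damp_le_1]. Qed.

Lemma inner_bounds (l rho x : R) : 0 <= inner l rho x <= 1.
Proof. apply integral_phi_bounded; [apply damp_max_cont | intros; apply damp_bounds]. Qed.

Lemma inner_cont (l rho x : R) : 0 < l -> Rabs rho <= 1 -> continuous (inner l rho) x.
Proof.
  intros Hl Hr; apply (lipschitz_continuous _ l); intros x'.
  assert (I : forall x, integrable
    (fun y => phi y * damp l (Rmax x (rho * x + sqrt (1 - rho ^ 2) * y)))).
  { intros; apply integrable_phi_bounded; [apply damp_max_cont | intros; apply damp_bounds]. }
  unfold inner; rewrite <- integral_minus by apply I.
  replace (l * Rabs (x' - x)) with (l * Rabs (x' - x) * integral phi)
    by (rewrite integral_phi; ring).
  rewrite <- integral_scal by apply integrable_phi.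
  apply integral_Rabs_le.
  - apply integrable_minus; apply I.
  - apply integrable_scal, integrable_phi.
  - intros y; rewrite <- Rmult_minus_distr_l, Rabs_mult, (Rabs_pos_eq (phi y)), Rmult_comm
      by (left; apply phi_pos).
    apply Rmult_le_compat_r; [left; apply phi_pos |].
    eapply Rle_trans; [now apply damp_lipschitz |].
    apply Rmult_le_compat_l; [lra | now apply Rmax_lipschitz].
Qed.

Lemma integrable_phi_inner (l rho : R) :
  0 < l -> Rabs rho <= 1 -> integrable (fun x => phi x * inner l rho x).
Proof.
  intros; apply integrable_phi_bounded; [intros; now apply inner_cont | intros; apply inner_bounds].
Qed.

Lemma E_BVN_inner (l rho : R) :
  0 < l -> E_BVN rho (acc l) = integral (fun x => phi x * inner l rho x).
Proof.
  intros Hl; apply integral_ext; intros x; unfold inner.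
  rewrite <- (integral_scal (phi x)).
  - apply integral_ext; intros y; rewrite acc_damp by easy; ring.
  - apply integrable_phi_bounded; [apply damp_max_cont | intros; apply damp_bounds].
Qed.

Lemma E_BVN_nonneg (l rho : R) : 0 < l -> Rabs rho <= 1 -> 0 <= E_BVN rho (acc l).
Proof.
  intros Hl Hr; rewrite E_BVN_inner by easy.
  apply integral_phi_bounded; [intros; now apply inner_cont | intros; apply inner_bounds].
Qed.

(* The maximum of two standard normals with correlation [rho] has density
   [2 phi(m) Phi(tau m)], [tau = sqrt ((1 - rho) / (1 + rho))]. *)
Definition expect (l tau : R) : R := integral (fun m => phi m * (damp l m * (2 * Phi (tau * m)))).

Lemma Phi_lin_cont (tau m : R) : continuous (fun m => Phi (tau * m)) m.
Proof. apply (cont_comp (fun m => tau * m)); [cont | apply Phi_cont]. Qed.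

Lemma damp_Phi_cont (l tau m : R) : continuous (fun m => damp l m * (2 * Phi (tau * m))) m.
Proof.
  pose proof (damp_cont l m); pose proof (Phi_lin_cont tau m).
  apply (cont_mult (damp l)); [easy |]; apply (cont_mult (fun _ => 2)); [cont | easy].
Qed.

Lemma integrable_expect (l tau : R) :
  integrable (fun m => phi m * (damp l m * (2 * Phi (tau * m)))).
Proof.
  apply (integrable_phi_mult _ 2); [apply damp_Phi_cont |].
  intros m; pose proof (damp_bounds l m); pose proof (Phi_nonneg (tau * m)).
  pose proof (Phi_lt_1 (tau * m)).
  rewrite Rabs_pos_eq by nra; nra.
Qed.

(** Degenerate case [Z2 = Z1], kept apart because the joint density used for smaller correlations
    divides by a standard deviation that is 0 here. *)
Lemma E_BVN_expect_1 (l : R) : 0 < l -> E_BVN 1 (acc l) = expect l 0.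
Proof.
  intros Hl; rewrite E_BVN_inner by easy; apply integral_ext; intros x.
  rewrite Rmult_0_l, Phi_0; f_equal; unfold inner.
  rewrite (integral_ext _ (fun y => damp l x * phi y)).
  - rewrite integral_scal, integral_phi by apply integrable_phi; field.
  - intros y; replace (1 - 1 ^ 2) with 0 by ring.
    rewrite sqrt_0, Rmult_0_l, Rplus_0_r, Rmult_1_l, Rmax_left by lra; ring.
Qed.

Lemma Phi_lim_scaled (c : R) : 0 < c -> is_lim (fun x => Phi (- c * x)) p_infty 0.
Proof.
  intros Hc; apply (filterlim_comp _ _ _ (fun x => - c * x) Phi _ (Rbar_locally m_infty));
    [| apply Phi_lim_m].
  intros P [M HM]; exists (- M / c); intros x Hx; apply HM.
  apply Rmult_lt_compat_l with (r := c) in Hx; [| easy].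
  replace (c * (- M / c)) with (- M) in Hx by (field; lra); lra.
Qed.

(** * Reduction to one dimension for a nondegenerate correlation *)

Section Correlated.

Variables (l rho : R).
Hypothesis (Hl : 0 < l) (Hr : Rabs rho < 1).

(** The standard deviation of [Z2] given [Z1]. As [s^2 = (1 - rho) * (1 + rho)], the quotient [tau]
    below is [sqrt ((1 - rho) / (1 + rho))]. *)
Let s := sqrt (1 - rho ^ 2).
Let tau := (1 - rho) / s.

Lemma sigma_sq : s ^ 2 = 1 - rho ^ 2.
Proof. apply pow2_sqrt; apply Rabs_def2 in Hr; nra. Qed.

Lemma sigma_pos : 0 < s.
Proof. apply sqrt_lt_R0; apply Rabs_def2 in Hr; nra. Qed.

(** The joint density of [(Z1, Z2)] times the acceptance function. The argument of the second [phi]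
    is [(z - rho * x) / s], written as an affine map of [z] for [RInt_affine]. *)
Definition kernel (x z : R) : R :=
  phi x * phi (/ s * z + - rho * x / s) / s * damp l (Rmax x z).

(** Both exponents equal [- (x^2 - 2 * rho * x * z + z^2) / (2 * s^2)]. *)
Lemma kernel_sym (x z : R) : kernel x z = kernel z x.
Proof.
  pose proof sigma_pos; pose proof sigma_sq; pose proof sqrt_2PI_gt_1.
  unfold kernel; rewrite (Rmax_comm z x); f_equal; f_equal; unfold phi.
  assert (E : exp (- x ^ 2 / 2) * exp (- (/ s * z + - rho * x / s) ^ 2 / 2) =
    exp (- z ^ 2 / 2) * exp (- (/ s * x + - rho * z / s) ^ 2 / 2)).
  { rewrite <- !exp_plus; f_equal.
    apply Rmult_eq_reg_r with (2 * s ^ 2); [| nra].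
    transitivity (- x ^ 2 * s ^ 2 - (z - rho * x) ^ 2); [field; lra |].
    transitivity (- z ^ 2 * s ^ 2 - (x - rho * z) ^ 2); [rewrite H0; ring | field; lra]. }
  transitivity (exp (- x ^ 2 / 2) * exp (- (/ s * z + - rho * x / s) ^ 2 / 2) /
      sqrt (2 * PI) ^ 2); [field; lra | rewrite E; field; lra].
Qed.

Lemma kernel_cont (x z : R) : continuity_2d_pt kernel x z.
Proof.
  unfold kernel.
  assert (C : forall f : R -> R, (forall y, continuous f y) -> forall y, continuity_pt f y)
    by (intros f Hf y; apply continuity_pt_filterlim, Hf).
  apply (continuity_2d_pt_mult (fun x z => phi x * phi (/ s * z + - rho * x / s) / s));
    [apply (continuity_2d_pt_mult (fun x z => phi x * phi (/ s * z + - rho * x / s)));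
      [apply (continuity_2d_pt_mult (fun x z => phi x)) | apply continuity_2d_pt_const] |].
  - apply (continuity_1d_2d_pt_comp phi (fun x _ => x));
      [apply C, phi_cont | apply continuity_2d_pt_id1].
  - apply (continuity_1d_2d_pt_comp phi (fun x z => / s * z + - rho * x / s));
      [apply C, phi_cont |]; unfold Rdiv.
    repeat first [ apply continuity_2d_pt_mult | apply continuity_2d_pt_plus
      | apply continuity_2d_pt_id1 | apply continuity_2d_pt_id2 | apply continuity_2d_pt_const ].
  - apply (continuity_1d_2d_pt_comp (damp l) Rmax); [apply C, damp_cont |].
    apply (continuity_2d_pt_ext (fun x z => (x + z + Rabs (x - z)) * / 2)).
    + intros u v; unfold Rmax, Rabs; destruct (Rle_dec u v), (Rcase_abs (u - v)); lra.
    + apply continuity_2d_pt_mult; [| apply continuity_2d_pt_const].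
      apply continuity_2d_pt_plus.
      * apply continuity_2d_pt_plus; [apply continuity_2d_pt_id1 | apply continuity_2d_pt_id2].
      * apply (continuity_1d_2d_pt_comp Rabs (fun x z => x - z));
          [apply C; intros; now apply continuous_Rabs |].
        apply continuity_2d_pt_minus; [apply continuity_2d_pt_id1 | apply continuity_2d_pt_id2].
Qed.

Lemma phi_affine_cont (u v x : R) : continuous (fun x => phi (u * x + v)) x.
Proof. apply (cont_comp (fun x => u * x + v)); [cont | apply phi_cont]. Qed.

(** Below the diagonal the maximum is [m], so [damp] is constant and only a normal density is
    integrated. The upper limit [(m - rho * m) / s] is where [tau * m] comes from. *)
Lemma RInt_kernel_diag (c m : R) : c <= m ->
  RInt (kernel m) c m = damp l m * phi m * (Phi (tau * m) - Phi ((c - rho * m) / s)).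
Proof.
  intros Hcm; pose proof sigma_pos.
  rewrite (RInt_ext _ (fun z => damp l m * phi m * (/ s * phi (/ s * z + - rho * m / s)))).
  - rewrite RInt_mult_l, RInt_mult_l by
      (intros; try apply (cont_mult (fun _ => / s)); try apply cont_const; apply phi_affine_cont).
    rewrite RInt_affine, RInt_phi by apply phi_cont.
    f_equal; f_equal; f_equal; unfold tau; field; lra.
  - intros z [_ Hz]; rewrite Rmax_right in Hz by easy; eqR; unfold kernel.
    rewrite Rmax_left by lra; field; lra.
Qed.

(** For every [x] in [[-B, B]], the interval of [z] in [[-B, B]], standardised as
    [(z - rho * x) / s], contains [[- kappa * B, kappa * B]]. This makes the tail bounds uniform in
    [x]. *)
Let kappa := (1 - Rabs rho) / s.

Lemma inner_truncated (B x : R) : - B <= x <= B ->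
  RInt (kernel x) (- B) B <= phi x * inner l rho x
    <= RInt (kernel x) (- B) B + phi x * (2 * Phi (- kappa * B)).
Proof.
  intros Hx; pose proof sigma_pos as Hs.
  set (h := fun y => damp l (Rmax x (rho * x + s * y))).
  assert (Hh : forall y, continuous h y) by apply damp_max_cont.
  assert (E : RInt (kernel x) (- B) B =
    phi x * RInt (fun y => phi y * h y) (/ s * - B + - rho * x / s) (/ s * B + - rho * x / s)).
  { assert (Hph : forall y, continuous (fun y => phi y * h y) y)
      by (intros y; apply (cont_mult phi h); [apply phi_cont | apply Hh]).
    rewrite <- RInt_affine, <- !RInt_mult_l.
    - apply RInt_ext; intros z _; eqR; unfold kernel, h.
      replace (rho * x + s * (/ s * z + - rho * x / s)) with z by (field; lra); field; lra.
    - intros y; apply (cont_mult (fun _ => / s)); [cont |].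
      apply (cont_comp (fun z => / s * z + - rho * x / s) (fun y => phi y * h y));
        [cont | apply Hph].
    - intros y; apply (cont_comp (fun z => / s * z + - rho * x / s) (fun y => phi y * h y));
        [cont | apply Hph].
    - apply Hph. }
  rewrite E.
  assert (Hi : 0 < / s) by now apply Rinv_0_lt_compat.
  assert (Hrx : Rabs (rho * x) <= Rabs rho * B).
  { rewrite Rabs_mult; apply Rmult_le_compat_l; [apply Rabs_pos | apply Rabs_le; lra]. }
  apply Rabs_le_between in Hrx.
  set (A := / s * - B + - rho * x / s); set (Y := / s * B + - rho * x / s).
  assert (HA : A <= - kappa * B).
  { unfold A, kappa, Rdiv; nra. }
  assert (HY : - Y <= - kappa * B).
  { unfold Y, kappa, Rdiv; nra. }
  assert (HAY : A <= Y) by (unfold A, Y; nra).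
  pose proof (integral_phi_truncated h A Y HAY Hh (fun y => damp_bounds l _)) as T.
  change (inner l rho x) with (integral (fun y => phi y * h y)).
  pose proof (phi_pos x); pose proof (Phi_le _ _ HA); pose proof (Phi_le _ _ HY); split.
  - apply Rmult_le_compat_l; lra.
  - rewrite <- Rmult_plus_distr_l; apply Rmult_le_compat_l; lra.
Qed.

(** Both integrals lie between the double integral of [kernel] over the square and that value plus
    the error [e]: the first by [inner_truncated], the second because it only drops the term
    [Phi ((- B - rho * m) / s)]. *)
Lemma E_BVN_truncated (B : R) : 0 <= B ->
  Rabs (RInt (fun x => phi x * inner l rho x) (- B) B -
    RInt (fun m => phi m * (damp l m * (2 * Phi (tau * m)))) (- B) B) <= 2 * Phi (- kappa * B).
Proof.
  intros HB; pose proof sigma_pos as Hs.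
  assert (HBB : - B <= B) by lra.
  assert (Hin : forall x, continuous (fun x => phi x * inner l rho x) x)
    by (apply integrable_phi_inner; lra).
  assert (Hker : forall x, continuous (fun x => RInt (kernel x) (- B) B) x)
    by (intros; apply continuous_RInt_param, kernel_cont).
  pose (h := fun m => damp l m * phi m * (Phi (tau * m) - Phi ((- B - rho * m) / s))).
  assert (HPc : forall m, continuous (fun m => Phi ((- B - rho * m) / s)) m).
  { intros m; apply (cont_comp (fun m => (- B - rho * m) / s)); [cont | apply Phi_cont]. }
  assert (Hh : forall m, continuous h m).
  { intros m; pose proof (damp_cont l m); pose proof (Phi_lin_cont tau m); pose proof (HPc m).
    pose proof (phi_cont m); unfold h.
    apply (cont_mult (fun m => damp l m * phi m)); [now apply (cont_mult (damp l)) |].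
    now apply (cont_minus (fun m => Phi (tau * m))). }
  assert (Hexp : forall m, continuous (fun m => phi m * (damp l m * (2 * Phi (tau * m)))) m)
    by apply integrable_expect.
  assert (Hphi : forall c x, continuous (fun x => c * phi x) x)
    by (intros; apply (cont_mult (fun _ => c)); [cont | apply phi_cont]).
  assert (Sq : RInt (fun x => RInt (kernel x) (- B) B) (- B) B = RInt (fun m => 2 * h m) (- B) B).
  { apply RInt_square_symmetric; [easy | apply kernel_cont | apply kernel_sym | | easy].
    intros m Hm; unfold h; now rewrite RInt_kernel_diag. }
  assert (Tot : RInt phi (- B) B <= 1).
  { rewrite <- integral_phi; apply RInt_le_integral;
      [easy | apply integrable_phi | intros; left; apply phi_pos]. }
  set (e := 2 * Phi (- kappa * B)).
  assert (He : 0 <= e) by (unfold e; pose proof (Phi_pos (- kappa * B)); lra).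
  assert (U1 : RInt (fun x => RInt (kernel x) (- B) B) (- B) B <=
    RInt (fun x => phi x * inner l rho x) (- B) B).
  { apply RInt_le; [easy | now apply ex_RInt_cont | now apply ex_RInt_cont |].
    intros x Hx; apply inner_truncated; lra. }
  assert (U2 : RInt (fun x => phi x * inner l rho x) (- B) B <=
    RInt (fun x => RInt (kernel x) (- B) B) (- B) B + e * RInt phi (- B) B).
  { rewrite <- RInt_mult_l, <- RInt_sum by (try easy; apply phi_cont).
    apply RInt_le; [easy | now apply ex_RInt_cont | |].
    - apply ex_RInt_cont; intros x.
      apply (cont_plus (fun x => RInt (kernel x) (- B) B) (fun x => e * phi x)); easy.
    - intros x Hx; pose proof (inner_truncated B x ltac:(lra)); unfold e; lra. }
  assert (U3 : RInt (fun m => 2 * h m) (- B) B <=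
    RInt (fun m => phi m * (damp l m * (2 * Phi (tau * m)))) (- B) B).
  { apply RInt_le_cont; [easy | intros; cont | easy |].
    intros m; unfold h; pose proof (damp_pos l m); pose proof (phi_pos m).
    pose proof (Phi_pos ((- B - rho * m) / s)).
    assert (0 < damp l m * phi m) by now apply Rmult_lt_0_compat.
    nra. }
  assert (U4 : RInt (fun m => phi m * (damp l m * (2 * Phi (tau * m)))) (- B) B <=
    RInt (fun m => 2 * h m) (- B) B + e * RInt phi (- B) B).
  { rewrite <- RInt_mult_l, <- RInt_sum by (try easy; try apply phi_cont; intros; cont).
    apply RInt_le; [easy | now apply ex_RInt_cont | |].
    - apply ex_RInt_cont; intros x.
      apply (cont_plus (fun x => 2 * h x) (fun x => e * phi x)); [cont | easy].
    - intros m Hm; unfold h, e; pose proof (damp_pos l m); pose proof (damp_le_1 l m).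
      pose proof (phi_pos m).
      assert (Hrm : Rabs (rho * m) <= Rabs rho * B).
      { rewrite Rabs_mult; apply Rmult_le_compat_l; [apply Rabs_pos | apply Rabs_le; lra]. }
      apply Rabs_le_between in Hrm; assert (Hi : 0 < / s) by now apply Rinv_0_lt_compat.
      assert (HP : Phi ((- B - rho * m) / s) <= Phi (- kappa * B))
        by (apply Phi_le; unfold kappa, Rdiv; nra).
      pose proof (Phi_pos ((- B - rho * m) / s)).
      set (p := Phi ((- B - rho * m) / s)) in *; set (q := Phi (- kappa * B)) in *.
      assert (damp l m * p <= q) by nra.
      set (t := Phi (tau * m)); nra. }
  assert (e * RInt phi (- B) B <= e) by nra.
  apply Rabs_le; lra.
Qed.

Lemma E_BVN_expect_lt_1 : E_BVN rho (acc l) = expect l tau.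
Proof.
  pose proof sigma_pos as Hs; rewrite E_BVN_inner by easy.
  assert (Hi : integrable (fun x => phi x * inner l rho x)) by (apply integrable_phi_inner; lra).
  pose proof (integrable_expect l tau) as He.
  assert (Hk : 0 < kappa) by (apply Rdiv_lt_0_compat; lra).
  apply Rminus_diag_uniq; change (integral (fun x => phi x * inner l rho x) - expect l tau = 0).
  unfold expect; rewrite <- integral_minus by easy.
  apply integral_eq_lim; [now apply integrable_minus |].
  apply (is_lim_le_le_loc (fun B => - (2 * Phi (- kappa * B))) (fun B => 2 * Phi (- kappa * B))
    _ p_infty 0).
  - exists 0; intros B HB; rewrite <- Rabs_le_between.
    eapply Rle_trans; [| apply (E_BVN_truncated B); lra].
    right; f_equal; transitivity (RInt (fun x => phi x * inner l rho x +
      (-1) * (phi x * (damp l x * (2 * Phi (tau * x))))) (- B) B).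
    + apply RInt_ext; intros; eqR; ring.
    + assert (H1 := proj1 Hi); assert (H2 := proj1 He); rewrite RInt_sum, RInt_mult_l;
        [eqR; ring | easy | easy |].
      intros y; apply (cont_mult (fun _ => -1)); [cont | apply H2].
  - rewrite <- Ropp_0; apply (is_lim_opp (fun B => 2 * Phi (- kappa * B)) p_infty 0).
    rewrite <- (Rmult_0_r 2); now apply (is_lim_scal_l _ 2 p_infty 0), Phi_lim_scaled.
  - rewrite <- (Rmult_0_r 2); now apply (is_lim_scal_l _ 2 p_infty 0), Phi_lim_scaled.
Qed.

End Correlated.

(** * Dependence on the correlation and on the step size *)

Lemma damp_left (l m : R) : 0 < l -> m <= - l / 2 -> damp l m = 1.
Proof.
  intros Hl Hm; apply Rmin_left; rewrite <- exp_0; apply exp_le_compat; nra.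
Qed.

Lemma damp_right (l m : R) : 0 < l -> - l / 2 <= m -> damp l m = exp (- l * m - l ^ 2 / 2).
Proof.
  intros Hl Hm; apply Rmin_right; rewrite <- exp_0; apply exp_le_compat; nra.
Qed.

(** Completing the square: exponential tilting translates the normal density. *)
Lemma phi_shift (l m : R) : phi m * exp (- l * m - l ^ 2 / 2) = phi (m + l).
Proof.
  unfold phi, Rdiv; rewrite Rmult_assoc, (Rmult_comm (/ sqrt _)), <- Rmult_assoc, <- exp_plus.
  f_equal; f_equal; field.
Qed.

(** The acceptance probability of a single chain, and the normalising constant of the density
    [phi * damp l]. *)
Definition mass (l : R) : R := integral (fun m => phi m * damp l m).

Lemma phi_damp_cont (l m : R) : continuous (fun m => phi m * damp l m) m.
Proof. apply (cont_mult phi); [apply phi_cont | apply damp_cont]. Qed.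

Lemma integrable_mass (l : R) : integrable (fun m => phi m * damp l m).
Proof. apply integrable_phi_bounded; [apply damp_cont | apply damp_bounds]. Qed.

Lemma mass_pos (l : R) : 0 < mass l.
Proof.
  apply (integral_gt_0 _ 0); [apply integrable_mass | |].
  - intros m; pose proof (phi_pos m); pose proof (damp_pos l m); nra.
  - pose proof (phi_pos 0); pose proof (damp_pos l 0); nra.
Qed.

Lemma RInt_ext_open (f g : R -> R) (a b : R) :
  a <= b -> (forall x, a < x < b -> f x = g x) -> RInt f a b = RInt g a b.
Proof.
  intros Hab H; apply RInt_ext; intros x Hx; rewrite Rmin_left, Rmax_right in Hx by easy; now apply H.
Qed.

Lemma mass_eq (l : R) : 0 < l -> mass l = 2 * Phi (- l / 2).
Proof.
  intros Hl; apply integral_eq_lim; [apply integrable_mass |].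
  (* The truncation misses [Phi (- B)] on the left and [Phi (- (B + l))] on the right, together at
     most [2 * Phi (- B)]. The factor [- (1)] fits [Phi_lim_scaled]. *)
  apply (is_lim_le_le_loc (fun B => 2 * Phi (- l / 2) - 2 * Phi (- (1) * B))
    (fun _ => 2 * Phi (- l / 2)) _ p_infty (2 * Phi (- l / 2))).
  - exists l; intros B HB.
    assert (E : RInt (fun m => phi m * damp l m) (- B) B =
      2 * Phi (- l / 2) - Phi (- B) - Phi (- (B + l))).
    { rewrite (RInt_split _ (- B) (- l / 2) B) by apply phi_damp_cont.
      rewrite (RInt_ext_open _ phi (- B)), RInt_phi; [| lra |].
      - rewrite (RInt_ext_open _ (fun m => 1 * phi (1 * m + l)) (- l / 2)); [| lra |].
        + rewrite RInt_mult_l by apply phi_affine_cont.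
          rewrite RInt_affine, RInt_phi by apply phi_cont.
          rewrite (Phi_opp (B + l)), !Rmult_1_l.
          replace (- l / 2 + l) with (- (- l / 2)) by field; rewrite (Phi_opp (- l / 2)); eqR; ring.
        + intros x Hx; rewrite damp_right, phi_shift by lra; rewrite !Rmult_1_l; reflexivity.
      - intros x Hx; rewrite damp_left by lra; eqR; ring. }
    rewrite E; pose proof (Phi_pos (- B)); pose proof (Phi_pos (- (B + l))).
    pose proof (Phi_le (- (B + l)) (- B) ltac:(lra)).
    replace (- (1) * B) with (- B) by ring; lra.
  - assert (L : is_lim (fun B => 2 * Phi (- l / 2) - 2 * Phi (- (1) * B)) p_infty
      (2 * Phi (- l / 2) - 2 * 0)).
    { apply (is_lim_minus' (fun _ => 2 * Phi (- l / 2)) (fun B => 2 * Phi (- (1) * B)));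
        [apply is_lim_const |].
      apply (is_lim_scal_l _ 2 p_infty 0), Phi_lim_scaled; lra. }
    now replace (2 * Phi (- l / 2) - 2 * 0) with (2 * Phi (- l / 2)) in L by ring.
  - apply is_lim_const.
Qed.

Lemma expect_0 (l : R) : expect l 0 = mass l.
Proof.
  apply integral_ext; intros m; rewrite Rmult_0_l, Phi_0; field.
Qed.

Lemma expect_pos (l tau : R) : 0 < expect l tau.
Proof.
  assert (H : forall m, 0 < phi m * (damp l m * (2 * Phi (tau * m)))).
  { intros m; pose proof (Phi_pos (tau * m)).
    apply Rmult_lt_0_compat; [apply phi_pos |].
    apply Rmult_lt_0_compat; [apply damp_pos | lra]. }
  apply (integral_gt_0 _ 0); [apply integrable_expect | | apply H].
  intros m; left; apply H.
Qed.

(** * The gap function, its derivative and its concavity *)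

(** The odd part of [damp l] with the sign reversed, so that it has the sign of [m]. Only this part
    contributes against the odd function [2 * Phi (tau * m) - 1]. *)
Definition odd_damp (l m : R) : R := (damp l (- m) - damp l m) / 2.

Lemma odd_damp_cont (l m : R) : continuous (odd_damp l) m.
Proof.
  unfold odd_damp; pose proof (damp_cont l m).
  assert (continuous (fun m => damp l (- m)) m)
    by (apply (cont_comp (fun m => - m)); [cont | apply damp_cont]).
  apply (cont_div (fun m => damp l (- m) - damp l m)); now apply (cont_minus (fun m => damp l (- m))).
Qed.

Lemma odd_damp_le_1 (l m : R) : Rabs (odd_damp l m) <= 1.
Proof.
  unfold odd_damp; pose proof (damp_bounds l m); pose proof (damp_bounds l (- m)).
  apply Rabs_le; lra.
Qed.

Lemma odd_damp_le (l m : R) : 0 < l -> Rabs (odd_damp l m) <= l * Rabs m.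
Proof.
  intros Hl; unfold odd_damp, Rdiv; rewrite Rabs_mult, (Rabs_pos_eq (/ 2)) by lra.
  pose proof (damp_lipschitz l m (- m) Hl) as H.
  replace (- m - m) with (- (2 * m)) in H by ring.
  rewrite Rabs_Ropp, Rabs_mult, (Rabs_pos_eq 2) in H by lra; lra.
Qed.

Lemma odd_damp_sign (l m : R) : 0 < l -> 0 <= odd_damp l m * m.
Proof.
  intros Hl; unfold odd_damp; destruct (Rle_dec 0 m) as [H | H].
  - pose proof (damp_antitone l (- m) m Hl ltac:(lra)); apply Rmult_le_pos; lra.
  - pose proof (damp_antitone l m (- m) Hl ltac:(lra)).
    rewrite <- Rmult_opp_opp; apply Rmult_le_pos; lra.
Qed.

Lemma odd_damp_1_pos (l : R) : 0 < l -> 0 < odd_damp l 1.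
Proof.
  intros Hl; unfold odd_damp; rewrite (damp_right l 1) by lra.
  assert (exp (- l * 1 - l ^ 2 / 2) < damp l (- (1))); [| lra].
  apply Rmin_glb_lt.
  - apply Rlt_le_trans with (exp 0); [apply exp_increasing; nra | rewrite exp_0; lra].
  - apply exp_increasing; lra.
Qed.

Definition gap (l tau : R) : R :=
  integral (fun m => phi m * (odd_damp l m * (2 * Phi (tau * m) - 1))).

Definition slope (l tau : R) : R :=
  integral (fun m => phi m * (odd_damp l m * (2 * m * phi (tau * m)))).

Lemma integrable_gap (l tau : R) :
  integrable (fun m => phi m * (odd_damp l m * (2 * Phi (tau * m) - 1))).
Proof.
  apply (integrable_phi_mult _ 1).
  - intros m; pose proof (odd_damp_cont l m); pose proof (Phi_lin_cont tau m).
    apply (cont_mult (odd_damp l)); [easy |].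
    apply (cont_minus (fun m => 2 * Phi (tau * m))); [| cont].
    now apply (cont_mult (fun _ => 2)); [cont |].
  - intros m; rewrite Rabs_mult; pose proof (odd_damp_le_1 l m); pose proof (Rabs_pos (odd_damp l m)).
    assert (Rabs (2 * Phi (tau * m) - 1) <= 1).
    { pose proof (Phi_pos (tau * m)); pose proof (Phi_lt_1 (tau * m)); apply Rabs_le; lra. }
    pose proof (Rabs_pos (2 * Phi (tau * m) - 1)); nra.
Qed.

Lemma phi_lin_cont (tau m : R) : continuous (fun m => phi (tau * m)) m.
Proof. apply (cont_comp (fun m => tau * m)); [cont | apply phi_cont]. Qed.

Lemma integrable_slope (l tau : R) :
  integrable (fun m => phi m * (odd_damp l m * (2 * m * phi (tau * m)))).
Proof.
  apply (integrable_phi_mult _ 2).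
  - intros m; pose proof (odd_damp_cont l m); pose proof (phi_lin_cont tau m).
    apply (cont_mult (odd_damp l)); [easy |].
    now apply (cont_mult (fun m => 2 * m)); [cont |].
  - intros m; rewrite !Rabs_mult; pose proof (odd_damp_le_1 l m); pose proof (Rabs_pos (odd_damp l m)).
    rewrite (Rabs_pos_eq 2), (Rabs_pos_eq (phi _)) by (try lra; left; apply phi_pos).
    pose proof (phi_pos (tau * m)); pose proof (phi_lt_1 (tau * m)).
    pose proof (Rabs_pos m); rewrite <- (pow2_abs m).
    assert (Rabs (odd_damp l m) * phi (tau * m) <= 1) by nra.
    assert (0 <= Rabs (odd_damp l m) * phi (tau * m)) by nra.
    assert (Rabs m <= 1 + Rabs m ^ 2) by nra.
    replace (Rabs (odd_damp l m) * (2 * Rabs m * phi (tau * m))) with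
      (2 * (Rabs (odd_damp l m) * phi (tau * m) * Rabs m)) by ring; nra.
Qed.

(* Average the integrand of [expect] over [m] and [- m]. *)
Lemma expect_gap (l tau : R) : expect l tau = mass l - gap l tau.
Proof.
  pose proof (integrable_expect l tau) as He; pose proof (integrable_mass l) as Hm.
  pose proof (integrable_reflect _ He) as He'; pose proof (integrable_reflect _ Hm) as Hm'.
  pose proof (integrable_gap l tau) as Hg.
  assert (E1 := integral_reflect _ He); assert (E2 := integral_reflect _ Hm).
  fold (expect l tau) in E1; fold (mass l) in E2.
  assert (E : expect l tau + expect l tau = mass l + mass l - 2 * gap l tau).
  { rewrite <- E1 at 1; rewrite <- E2 at 1; unfold expect, mass, gap.
    rewrite <- integral_scal, <- !integral_plus, <- integral_minus by integ.
    apply integral_ext; intros m; unfold odd_damp.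
    rewrite phi_even, <- Ropp_mult_distr_r, Phi_opp; field. }
  lra.
Qed.

Lemma gap_0 (l : R) : gap l 0 = 0.
Proof. pose proof (expect_gap l 0); rewrite expect_0 in H; lra. Qed.

Lemma gap_lt_mass (l tau : R) : gap l tau < mass l.
Proof. pose proof (expect_gap l tau); pose proof (expect_pos l tau); lra. Qed.

(** A quadratic remainder bound can be integrated in a parameter, so this criterion carries a
    derivative through an improper integral. *)
Lemma is_derive_quadratic (f : R -> R) (x d K : R) :
  (forall y, Rabs (f y - f x - (y - x) * d) <= K * (y - x) ^ 2) -> is_derive f x d.
Proof.
  intros H; apply is_derive_Reals; intros eps Heps.
  assert (HK : 0 < Rabs K + 1) by (pose proof (Rabs_pos K); lra).
  assert (Hd : 0 < eps / (Rabs K + 1)) by now apply Rdiv_lt_0_compat.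
  exists (mkposreal _ Hd); intros h Hh Hlt; simpl in Hlt.
  specialize (H (x + h)); replace (x + h - x) with h in H by ring.
  replace ((f (x + h) - f x) / h - d) with ((f (x + h) - f x - h * d) / h) by (field; easy).
  assert (Hp : 0 < Rabs h) by now apply Rabs_pos_lt.
  unfold Rdiv; rewrite Rabs_mult, Rabs_inv.
  apply Rmult_lt_reg_r with (Rabs h); [easy |].
  rewrite Rmult_assoc, Rinv_l, Rmult_1_r by lra.
  eapply Rle_lt_trans; [exact H |]; rewrite <- (pow2_abs h).
  apply Rmult_lt_compat_l with (r := Rabs K + 1) in Hlt; [| easy].
  replace ((Rabs K + 1) * (eps / (Rabs K + 1))) with eps in Hlt by (field; lra).
  pose proof (Rle_abs K); simpl; rewrite Rmult_1_r, <- Rmult_assoc.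
  apply Rmult_lt_compat_r; [easy |]; nra.
Qed.

Lemma is_derive_gap (l tau : R) : is_derive (gap l) tau (slope l tau).
Proof.
  (* [Phi_taylor] at [tau * m] and [t * m] leaves [(t - tau)^2 * m^2]; the 2 is the factor of [Phi],
     and [odd_damp] is bounded by 1. *)
  pose (q := fun m => phi m * (2 * m ^ 2)).
  assert (Hq : integrable q).
  { apply (integrable_phi_mult _ 2); [intros; cont |]; intros m; rewrite Rabs_pos_eq; nra. }
  apply (is_derive_quadratic _ _ _ (integral q)); intros t.
  pose proof (integrable_gap l tau) as H0; pose proof (integrable_gap l t) as H1.
  pose proof (integrable_slope l tau) as H2.
  unfold gap, slope.
  rewrite <- integral_scal, <- !integral_minus by integ.
  rewrite (Rmult_comm (integral q)), <- integral_scal by easy.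
  apply integral_Rabs_le.
  - integ.
  - integ.
  - intros m; unfold q.
    replace (_ - _) with (phi m * (odd_damp l m *
      (2 * (Phi (t * m) - Phi (tau * m) - (t * m - tau * m) * phi (tau * m))))) by ring.
    rewrite !Rabs_mult, (Rabs_pos_eq (phi m)), (Rabs_pos_eq 2) by (try lra; left; apply phi_pos).
    pose proof (Phi_taylor (tau * m) (t * m)) as T; pose proof (odd_damp_le_1 l m).
    pose proof (Rabs_pos (odd_damp l m)); pose proof (phi_pos m).
    replace ((t - tau) ^ 2 * (phi m * (2 * m ^ 2))) with
      (phi m * (1 * (2 * (t * m - tau * m) ^ 2))) by ring.
    pose proof (Rabs_pos (Phi (t * m) - Phi (tau * m) - (t * m - tau * m) * phi (tau * m))).
    apply Rmult_le_compat_l; [lra |]; apply Rmult_le_compat; lra.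
Qed.

Lemma slope_integrand_nonneg (l tau m : R) :
  0 < l -> 0 <= phi m * (odd_damp l m * (2 * m * phi (tau * m))).
Proof.
  intros Hl; pose proof (odd_damp_sign l m Hl).
  replace (_ * _) with (2 * (phi m * phi (tau * m)) * (odd_damp l m * m)) by ring.
  pose proof (Rmult_lt_0_compat _ _ (phi_pos m) (phi_pos (tau * m))); nra.
Qed.

Lemma slope_pos (l tau : R) : 0 < l -> 0 < slope l tau.
Proof.
  intros Hl; apply (integral_gt_0 _ 1); [apply integrable_slope | |].
  - intros m; now apply slope_integrand_nonneg.
  - pose proof (odd_damp_1_pos l Hl); pose proof (phi_pos 1); pose proof (phi_pos (tau * 1)).
    apply Rmult_lt_0_compat; [easy |]; apply Rmult_lt_0_compat; lra.
Qed.

(** The weight [odd_damp l m * m] is nonnegative and [phi (t * m)] decreases in [t >= 0]. This is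
    the concavity of [gap l] on the half-line. *)
Lemma slope_antitone (l s t : R) : 0 < l -> 0 <= s <= t -> slope l t <= slope l s.
Proof.
  intros Hl Hst; apply integral_le; [apply integrable_slope | apply integrable_slope |].
  intros m; pose proof (odd_damp_sign l m Hl).
  assert (P : phi (t * m) <= phi (s * m)).
  { apply phi_le; rewrite !Rpow_mult_distr; apply Rmult_le_compat_r; [apply pow2_ge_0 |].
    apply pow_incr; lra. }
  apply Rmult_le_compat_l; [left; apply phi_pos |].
  replace (odd_damp l m * (2 * m * phi (t * m))) with (2 * (odd_damp l m * m) * phi (t * m)) by ring.
  replace (odd_damp l m * (2 * m * phi (s * m))) with (2 * (odd_damp l m * m) * phi (s * m)) by ring.
  apply Rmult_le_compat_l; lra.
Qed.

Lemma gap_increasing (l s t : R) : 0 < l -> s < t -> gap l s < gap l t.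
Proof.
  intros Hl Hst; destruct (mean_value (gap l) (slope l) s t (is_derive_gap l)) as [c [_ Hc]].
  pose proof (slope_pos l c Hl); nra.
Qed.

(** The chord of [gap l] from 0 to [t] has slope [slope l c] for some [c] in [[0, t]]; by concavity
    it lies between the end slopes, which gives this bound and the next. *)
Lemma slope_le_gap (l t : R) : 0 < l -> 0 <= t -> t * slope l t <= gap l t.
Proof.
  intros Hl Ht; destruct (mean_value (gap l) (slope l) 0 t (is_derive_gap l)) as [c [Hcc Hc]].
  rewrite Rmin_left, Rmax_right in Hcc by easy; rewrite gap_0 in Hc.
  pose proof (slope_antitone l c t Hl Hcc); nra.
Qed.

Lemma gap_le_slope_0 (l t : R) : 0 < l -> 0 <= t -> gap l t <= t * slope l 0.
Proof.
  intros Hl Ht; destruct (mean_value (gap l) (slope l) 0 t (is_derive_gap l)) as [c [Hcc Hc]].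
  rewrite Rmin_left, Rmax_right in Hcc by easy; rewrite gap_0 in Hc.
  pose proof (slope_antitone l 0 c Hl ltac:(lra)); nra.
Qed.

(* Concavity on the half-line. *)
Lemma gap_ratio_antitone (l s t : R) : 0 < l -> 0 < s <= t -> gap l t * s <= gap l s * t.
Proof.
  intros Hl Hst; destruct (mean_value (gap l) (slope l) s t (is_derive_gap l)) as [c [Hcc Hc]].
  rewrite Rmin_left, Rmax_right in Hcc by easy.
  pose proof (slope_antitone l s c Hl ltac:(lra)); pose proof (slope_le_gap l s Hl ltac:(lra)).
  assert (gap l t - gap l s <= slope l s * (t - s)) by (rewrite Hc; nra).
  nra.
Qed.

(** Uniform in [tau], from the Lipschitz constant [l] of [damp l]; it governs the limit of small
    step sizes. *)
Lemma gap_le_linear : exists K, forall l tau, 0 < l -> gap l tau <= l * K.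
Proof.
  assert (Hq : integrable (fun m => phi m * (1 + m ^ 2))).
  { apply (integrable_phi_mult _ 1); [intros; cont |]; intros m; rewrite Rabs_pos_eq; nra. }
  exists (integral (fun m => phi m * (1 + m ^ 2))); intros l tau Hl.
  rewrite <- integral_scal by easy.
  apply integral_le; [apply integrable_gap | now apply integrable_scal |].
  intros m; replace (l * (phi m * (1 + m ^ 2))) with (phi m * (l * (1 + m ^ 2))) by ring.
  apply Rmult_le_compat_l; [left; apply phi_pos |].
  eapply Rle_trans; [apply Rle_abs |]; rewrite Rabs_mult.
  assert (Rabs (2 * Phi (tau * m) - 1) <= 1).
  { pose proof (Phi_pos (tau * m)); pose proof (Phi_lt_1 (tau * m)); apply Rabs_le; lra. }
  pose proof (odd_damp_le l m Hl); pose proof (Rabs_pos (odd_damp l m)).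
  pose proof (Rabs_pos (2 * Phi (tau * m) - 1)); rewrite <- (pow2_abs m).
  pose proof (pow2_ge_0 (Rabs m - 1)); assert (Rabs m <= 1 + Rabs m ^ 2) by nra.
  apply Rle_trans with (l * Rabs m); nra.
Qed.

(** * Comparison of step sizes *)

(** The ratio [damp l' / damp l] is 1 up to [- l' / 2], equals the decreasing [damp l'] up to
    [- l / 2], and is then exponential with rate [- (l' - l)]. The three pieces are chained at the
    breakpoints. *)
Lemma damp_ratio_antitone (l l' x y : R) : 0 < l < l' -> x <= y ->
  damp l' y * damp l x <= damp l' x * damp l y.
Proof.
  intros Hl Hxy.
  assert (main : forall x y, x <= y ->
    (y <= - l' / 2 \/ (- l' / 2 <= x /\ y <= - l / 2) \/ - l / 2 <= x) ->
    damp l' y * damp l x <= damp l' x * damp l y).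
  { clear x y Hxy; intros x y Hxy [H | [[H1 H2] | H]].
    - rewrite !damp_left by lra; lra.
    - rewrite (damp_left l x), (damp_left l y) by lra.
      pose proof (damp_antitone l' x y ltac:(lra) Hxy); lra.
    - rewrite !damp_right, <- !exp_plus by lra; apply exp_le_compat; nra. }
  assert (chain : forall z, x <= z <= y ->
    damp l' z * damp l x <= damp l' x * damp l z ->
    damp l' y * damp l z <= damp l' z * damp l y ->
    damp l' y * damp l x <= damp l' x * damp l y).
  { intros z Hz H1 H2; pose proof (damp_pos l z); pose proof (damp_pos l' z).
    pose proof (damp_pos l x); pose proof (damp_pos l' y).
    apply Rmult_le_reg_r with (damp l z * damp l' z); [nra |].
    replace (damp l' y * damp l x * (damp l z * damp l' z)) with
      ((damp l' z * damp l x) * (damp l' y * damp l z)) by ring.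
    replace (damp l' x * damp l y * (damp l z * damp l' z)) with
      ((damp l' x * damp l z) * (damp l' z * damp l y)) by ring.
    apply Rmult_le_compat; nra. }
  destruct (Rle_dec y (- l' / 2)) as [Hy | Hy]; [apply main; auto |].
  destruct (Rle_dec (- l / 2) x) as [Hx | Hx]; [apply main; auto |].
  assert (Hin : - l' / 2 <= - l / 2) by lra.
  assert (mid : forall x, x <= y -> - l' / 2 <= x <= - l / 2 ->
    damp l' y * damp l x <= damp l' x * damp l y).
  { intros z Hzy Hz; destruct (Rle_dec y (- l / 2)) as [Hy2 | Hy2].
    - apply main; [easy |]; right; left; lra.
    - clear chain; pose proof (main z (- l / 2) ltac:(lra) ltac:(right; left; lra)) as A.
      pose proof (main (- l / 2) y ltac:(lra) ltac:(right; right; lra)) as B.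
      rewrite (damp_left l (- l / 2)), (damp_left l z) in * by lra.
      pose proof (damp_pos l y); pose proof (damp_pos l' z); nra. }
  destruct (Rle_dec (- l' / 2) x) as [Hx2 | Hx2]; [apply mid; lra |].
  apply (chain (- l' / 2)); [lra | apply main; lra | apply mid; lra].
Qed.

(* Chebyshev's inequality for the likelihood ratio [damp l' / damp l], which
   decreases while [Phi (tau * m)] increases. *)
Lemma expect_ratio_decreasing (l l' tau : R) : 0 < l < l' -> 0 < tau ->
  expect l' tau * mass l < expect l tau * mass l'.
Proof.
  intros Hl Ht.
  pose proof (mass_pos l) as M; pose proof (mass_pos l') as M'.
  assert (Hlt : mass l' < mass l) 
    by (rewrite !mass_eq by lra; pose proof (Phi_incr (- l' / 2) (- l / 2)); lra).
  (* The sign of [damp l' - q * damp l] compares the two normalised densities; it changes once, at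
     [x0] below. *)
  set (q := mass l' / mass l).
  assert (Hq : 0 < q < 1).
  { unfold q; split; [now apply Rdiv_lt_0_compat |].
    apply Rmult_lt_reg_r with (mass l); [easy |]; unfold Rdiv; rewrite Rmult_assoc, Rinv_l; lra. }
  assert (Hqm : q * mass l = mass l') by (unfold q; field; lra).
  assert (X : exists x, damp l' x = q * damp l x).
  { set (x1 := - ln q / (l' - l)).
    assert (Hln : ln q < 0) by (rewrite <- ln_1; now apply ln_increasing).
    assert (Hx1 : 0 < x1) by (apply Rdiv_lt_0_compat; lra).
    assert (H1 : damp l' x1 - q * damp l x1 <= 0).
    { rewrite !damp_right by lra.
      replace q with (exp (ln q)) by (apply exp_ln; lra).
      rewrite <- exp_plus.
      assert (E : (l' - l) * x1 = - ln q) by (unfold x1; field; lra).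
      assert (exp (- l' * x1 - l' ^ 2 / 2) <= exp (ln q + (- l * x1 - l ^ 2 / 2))); [| lra].
      apply exp_le_compat; nra. }
    assert (H2 : 0 <= damp l' (- l') - q * damp l (- l')) by (rewrite !damp_left by lra; lra).
    destruct (IVT_gen (fun x => damp l' x - q * damp l x) (- l') x1 0) as [x [_ Hx]].
    - intros x; apply continuity_pt_filterlim.
      pose proof (damp_cont l x); pose proof (damp_cont l' x).
      apply (cont_minus (damp l') (fun x => q * damp l x)); [easy |].
      apply (cont_mult (fun _ => q)); [cont | easy].
    - rewrite Rmin_right, Rmax_left; lra.
    - exists x; lra. }
  destruct X as [x0 Hx0].
  assert (S : forall m, (m <= x0 -> q * damp l m <= damp l' m) /\
    (x0 <= m -> damp l' m <= q * damp l m)).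
  { intros m; pose proof (damp_pos l x0); pose proof (damp_pos l' x0); split; intros Hm.
    - pose proof (damp_ratio_antitone l l' m x0 Hl Hm) as R; rewrite Hx0 in R; nra.
    - pose proof (damp_ratio_antitone l l' x0 m Hl Hm) as R; rewrite Hx0 in R; nra. }
  assert (Hx0l : - l' < x0).
  { apply Rnot_le_lt; intros H; rewrite !damp_left in Hx0 by lra; lra. }
  set (c := 2 * Phi (tau * x0)).
  pose proof (integrable_expect l tau) as I1; pose proof (integrable_expect l' tau) as I2.
  pose proof (integrable_mass l) as I3; pose proof (integrable_mass l') as I4.
  (* The difference of the integrands is [phi m * (damp l' m - q * damp l m) * (2 * Phi (tau * m) -
     c)]; the last two factors change sign at [x0] in opposite directions. After integration the
     terms in [c] cancel, since [q * mass l = mass l']. Strictness is checked at [- l'], which lies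
     left of [x0]. *)
  assert (J : integral (fun m => phi m * (damp l' m * (2 * Phi (tau * m)))
      + q * (c * (phi m * damp l m))) <
    integral (fun m => q * (phi m * (damp l m * (2 * Phi (tau * m)))) + c * (phi m * damp l' m))).
  { apply (integral_lt _ _ (- l')).
    - integ.
    - integ.
    - intros m; apply Rminus_le.
      replace (_ - _) with (phi m * ((damp l' m - q * damp l m) * (2 * Phi (tau * m) - c))) by ring.
      pose proof (phi_pos m).
      assert ((damp l' m - q * damp l m) * (2 * Phi (tau * m) - c) <= 0); [| nra].
      destruct (S m) as [S1 S2]; destruct (Rle_dec m x0) as [Hm | Hm].
      + specialize (S1 Hm); unfold c.
        pose proof (Phi_le (tau * m) (tau * x0) ltac:(apply Rmult_le_compat_l; lra)); nra.
      + specialize (S2 ltac:(lra)); unfold c.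
        pose proof (Phi_le (tau * x0) (tau * m) ltac:(apply Rmult_le_compat_l; lra)); nra.
    - apply Rminus_lt.
      replace (_ - _) with 
        (phi (- l') * ((damp l' (- l') - q * damp l (- l')) * (2 * Phi (tau * - l') - c))) by ring.
      rewrite !damp_left by lra; pose proof (phi_pos (- l')).
      pose proof (Phi_incr (tau * - l') (tau * x0) ltac:(apply Rmult_lt_compat_l; lra)); unfold c.
      assert ((1 - q * 1) * (2 * Phi (tau * - l') - 2 * Phi (tau * x0)) < 0) by nra; nra. }
  rewrite !integral_plus, !integral_scal in J by integ.
  fold (expect l tau) (expect l' tau) (mass l) (mass l') in J.
  assert (expect l' tau < q * expect l tau) by (rewrite <- Hqm in J; lra).
  rewrite <- Hqm; nra.
Qed.

(** For large [l] the density proportional to [phi * damp l] concentrates at [- l / 2], with mean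
    absolute deviation at most [2 / l]. The Lipschitz bound on [Phi] then replaces [Phi (tau * m)]
    by its value there. *)
Lemma expect_le_large (l tau : R) : 0 < l -> 0 < tau ->
  expect l tau <= mass l * (2 * Phi (- tau * (l / 2)) + 4 * tau / l).
Proof.
  intros Hl Ht; set (a := l / 2).
  assert (Ha : 0 < a) by (unfold a; lra).
  assert (Iw : integrable (fun m => phi m * (damp l m * Rabs (m + a)))).
  { apply (integrable_phi_mult _ (1 + a)).
    - intros m; pose proof (damp_cont l m); apply (cont_mult (damp l)); [easy | cont].
    - intros m; pose proof (damp_bounds l m); rewrite Rabs_mult, Rabs_Rabsolu, Rabs_pos_eq by lra.
      pose proof (Rabs_triang m a); rewrite (Rabs_pos_eq a) in H0 by lra.
      pose proof (Rabs_pos (m + a)); rewrite <- (pow2_abs m).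
      pose proof (pow2_ge_0 (Rabs m - 1)).
      apply Rle_trans with (Rabs (m + a)); nra. }
  set (T := integral (fun m => phi m * (damp l m * Rabs (m + a)))).
  pose proof (integrable_mass l) as Im.
  set (g := fun m => phi m * damp l m + - a * (phi m * (damp l m * Rabs (m + a)))).
  assert (Hc : forall m, continuous g m).
  { unfold g; apply integrable_plus; [easy | now apply integrable_scal]. }
  (* The integrand dominates the derivative of [(m + a) * phi m * damp l m]. *)
  assert (HT : a * T <= mass l).
  { enough (0 <= mass l + - a * T) by lra.
    unfold mass, T; rewrite <- integral_scal, <- integral_plus by integ.
    apply (filterlim_le (F := Rbar_locally p_infty) (fun _ => 0)
      (fun B => RInt g (- B) B) 0 (integral g)).
    - exists a; intros B HB.
      rewrite (RInt_split _ (- B) (- a) B) by easy.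
      assert (L : RInt (fun m => (1 - m * (m + a)) * phi m) (- B) (- a) = (B - a) * phi B).
      { rewrite (RInt_derive_cont (fun m => (m + a) * phi m)).
        - rewrite !phi_even; eqR; ring.
        - intros m; pose proof (is_derive_phi m); auto_derive; [now exists (- m * phi m) |].
          replace (Derive _ m) with (- m * phi m) by (symmetry; now apply is_derive_unique); ring.
        - intros m; pose proof (phi_cont m); apply (cont_mult (fun m => 1 - m * (m + a))); [cont | easy]. }
      assert (U : RInt (fun m => (1 - (m + a) * (m + l)) * phi (1 * m + l)) (- a) B =
        (B + a) * phi (B + l)).
      { rewrite (RInt_derive_cont (fun m => (m + a) * phi (1 * m + l))).
        - replace (1 * B + l) with (B + l) by ring; eqR; ring.
        - intros m; pose proof (is_derive_phi (1 * m + l)); auto_derive;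
            [eexists; apply H |].
          replace (Derive _ _) with (- (1 * m + l) * phi (1 * m + l))
            by (symmetry; now apply is_derive_unique); ring.
        - intros m; apply (cont_mult (fun m => 1 - (m + a) * (m + l)));
            [cont | apply phi_affine_cont]. }
      (* Left of [- a] the integrands differ by [(m + a)^2 * phi m]; right of it the comparison uses
         [m + l >= a]. The boundary terms at [- a] vanish and those at [- B] and [B] are
         nonnegative. *)
      assert (L' : (B - a) * phi B <= RInt g (- B) (- a)).
      { rewrite <- L; apply RInt_le; [lra | | now apply ex_RInt_cont |].
        - apply ex_RInt_cont; intros m; pose proof (phi_cont m).
          apply (cont_mult (fun m => 1 - m * (m + a))); [cont | easy].
        - intros m Hm; unfold g; rewrite damp_left, Rabs_left by (unfold a in *; lra).
          pose proof (phi_pos m).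
          pose proof (Rmult_le_pos _ _ (Rlt_le _ _ H) (pow2_ge_0 (m + a))); lra. }
      assert (U' : (B + a) * phi (B + l) <= RInt g (- a) B).
      { rewrite <- U; apply RInt_le; [lra | | now apply ex_RInt_cont |].
        - apply ex_RInt_cont; intros m.
          apply (cont_mult (fun m => 1 - (m + a) * (m + l))); [cont | apply phi_affine_cont].
        - intros m Hm; unfold g; rewrite Rabs_pos_eq by lra.
          rewrite <- (Rmult_assoc (phi m)), damp_right, phi_shift, Rmult_1_l by (unfold a in *; lra).
          pose proof (phi_pos (m + l)).
          assert (a * (m + a) <= (m + a) * (m + l)) by (unfold a in *; nra); nra. }
      pose proof (phi_pos B); pose proof (phi_pos (B + l)); nra.
    - apply filterlim_const.
    - apply integral_lim, integrable_plus; [easy | now apply integrable_scal]. }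
  apply Rle_trans with (2 * Phi (- tau * a) * mass l + 2 * tau * T).
  - unfold mass, T; rewrite <- !integral_scal, <- integral_plus by integ.
    apply integral_le; [apply integrable_expect | apply integrable_plus; now apply integrable_scal |].
    intros m; pose proof (Phi_lipschitz (- tau * a) (tau * m)) as H.
    replace (tau * m - - tau * a) with (tau * (m + a)) in H by ring.
    rewrite Rabs_mult, (Rabs_pos_eq tau) in H by lra.
    pose proof (Rle_abs (Phi (tau * m) - Phi (- tau * a))).
    pose proof (Rmult_lt_0_compat _ _ (phi_pos m) (damp_pos l m)).
    replace (phi m * (damp l m * (2 * Phi (tau * m)))) with
      ((phi m * damp l m) * (2 * Phi (tau * m))) by ring.
    replace (2 * Phi (- tau * a) * (phi m * damp l m) +
      2 * tau * (phi m * (damp l m * Rabs (m + a)))) with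
      ((phi m * damp l m) * (2 * Phi (- tau * a) + 2 * (tau * Rabs (m + a)))) by ring.
    apply Rmult_le_compat_l; lra.
  - replace (4 * tau / l) with (2 * tau / a) by (unfold a; field; lra).
    assert (T <= mass l / a).
    { apply Rmult_le_reg_l with a; [easy |]; replace (a * (mass l / a)) with (mass l) by (field; lra); easy. }
    replace (mass l * (2 * Phi (- tau * a) + 2 * tau / a)) with
      (2 * Phi (- tau * a) * mass l + 2 * tau * (mass l / a)) by (field; lra).
    nra.
Qed.

(** * The roots *)

(* Both couplings read [rho = 1 - u / k] with [u = 1 - v], where [k = 1] for CRN and
   [k = eps / (eps - 1)] for reflection; then [tau = sqrt (u / (2 k - u))]. *)
Definition tau (k u : R) : R := sqrt (u / (2 * k - u)).

Lemma tau_sq (k u : R) : 1 <= k -> 0 <= u <= 1 -> tau k u ^ 2 = u / (2 * k - u).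
Proof. intros Hk Hu; apply pow2_sqrt, Rle_mult_inv_pos; lra. Qed.

Lemma tau_pos (k u : R) : 1 <= k -> 0 < u <= 1 -> 0 < tau k u.
Proof. intros Hk Hu; apply sqrt_lt_R0, Rdiv_lt_0_compat; lra. Qed.

Lemma tau_le_sqrt (k u : R) : 1 <= k -> 0 <= u <= 1 -> tau k u <= sqrt u.
Proof.
  intros Hk Hu; apply sqrt_le_1_alt, Rle_trans with (u * 1); [| lra].
  apply Rmult_le_compat_l; [lra |]; rewrite <- Rinv_1; apply Rinv_le_contravar; lra.
Qed.

Lemma tau_le_1 (k u : R) : 1 <= k -> 0 <= u <= 1 -> tau k u <= 1.
Proof.
  intros Hk Hu; eapply Rle_trans; [now apply tau_le_sqrt |].
  rewrite <- sqrt_1; apply sqrt_le_1_alt; lra.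
Qed.

Lemma tau_decreasing_k (k k' u : R) : 1 <= k < k' -> 0 < u <= 1 -> tau k' u < tau k u.
Proof.
  intros Hk Hu; apply sqrt_lt_1_alt; split; [apply Rle_mult_inv_pos; lra |].
  apply Rmult_lt_compat_l; [lra |]; apply Rinv_lt_contravar; [nra | lra].
Qed.

Lemma tau_increasing (k u u' : R) : 1 <= k -> 0 < u < u' -> u' <= 1 -> tau k u < tau k u'.
Proof.
  intros Hk Hu Hu'; apply sqrt_lt_1_alt; split; [apply Rle_mult_inv_pos; lra |].
  apply Rmult_lt_reg_r with ((2 * k - u) * (2 * k - u')); [nra |].
  replace (u / (2 * k - u) * _) with (u * (2 * k - u')) by (field; lra).
  replace (u' / (2 * k - u') * _) with (u' * (2 * k - u)) by (field; lra); nra.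
Qed.

(** The square of [tau k u / u] is [1 / (u * (2 * k - u))], and [u * (2 * k - u)] increases up to
    [u = k >= 1]. *)
Lemma tau_ratio (k u u' : R) :
  1 <= k -> 0 < u < u' -> u' <= 1 -> tau k u' * u < tau k u * u'.
Proof.
  intros Hk Hu Hu'; pose proof (tau_pos k u Hk ltac:(lra)); pose proof (tau_pos k u' Hk ltac:(lra)).
  apply Rsqr_incrst_0; [| nra | nra].
  rewrite !Rsqr_mult, !Rsqr_pow2, !tau_sq by lra.
  apply Rmult_lt_reg_r with ((2 * k - u) * (2 * k - u')); [nra |].
  replace (u' / (2 * k - u') * u ^ 2 * _) with ((u * u') * (u * (2 * k - u))) by (field; lra).
  replace (u / (2 * k - u) * u' ^ 2 * _) with ((u * u') * (u' * (2 * k - u'))) by (field; lra).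
  apply Rmult_lt_compat_l; [nra |].
  assert (0 < (u' - u) * (2 * k - u - u')) by (apply Rmult_lt_0_compat; lra); lra.
Qed.

Lemma F_eq (l k v : R) (rho : R -> R) : 0 < l -> 1 <= k -> rho v = 1 - (1 - v) / k ->
  0 <= v <= 1 -> F l rho v = mass l * (1 - v) - gap l (tau k (1 - v)).
Proof.
  intros Hl Hk Hrho Hv; unfold F; rewrite Hrho, Rmult_assoc, (Rmult_comm v), <- Rmult_assoc,
    <- mass_eq by easy.
  enough (E : E_BVN (1 - (1 - v) / k) (acc l) = expect l (tau k (1 - v))).
  { rewrite E, expect_gap; ring. }
  destruct (Req_dec v 1) as [-> | Hv1].
  - unfold tau; rewrite Rminus_diag; unfold Rdiv; rewrite !Rmult_0_l, sqrt_0, Rminus_0_r.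
    now apply E_BVN_expect_1.
  - assert (Hx : 0 < (1 - v) / k <= 1).
    { split; [apply Rdiv_lt_0_compat; lra |].
      apply Rmult_le_reg_r with k; [lra |]; unfold Rdiv; rewrite Rmult_assoc, Rinv_l; lra. }
    set (x := (1 - v) / k) in *.
    assert (Hr : Rabs (1 - x) < 1) by (apply Rabs_def1; lra).
    rewrite E_BVN_expect_lt_1 by easy; f_equal.
    pose proof (sigma_pos _ Hr) as Hs; pose proof (sigma_sq _ Hr) as Hs2.
    symmetry; apply sqrt_lem_1.
    + apply Rle_mult_inv_pos; lra.
    + apply Rle_mult_inv_pos; lra.
    + set (s := sqrt (1 - (1 - x) ^ 2)) in *.
      (* With [x = 1 - rho], [s^2 = x * (2 - x)], so the squared ratio is
         [x / (2 - x) = u / (2 * k - u)]. *)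
      transitivity (x ^ 2 / s ^ 2); [field; lra |].
      rewrite Hs2; unfold x; field; repeat split; try lra.
      unfold x in Hx; nra.
Qed.

(** Excludes roots in [[-1, 0]]. For negative [v] the linear term is already positive; at [v = 0]
    the strict inequality [gap < mass] is needed. *)
Lemma F_pos (l k v : R) (rho : R -> R) : 0 < l -> 1 <= k -> rho v = 1 - (1 - v) / k ->
  -1 <= v <= 0 -> 0 < F l rho v.
Proof.
  intros Hl Hk Hrho Hv; destruct (Req_dec v 0) as [-> | Hv0].
  - rewrite (F_eq l k) by lra; pose proof (gap_lt_mass l (tau k (1 - 0))); lra.
  - unfold F; rewrite Hrho; pose proof (Phi_pos (- l / 2)).
    assert (0 < (1 - v) / k <= 2).
    { split; [apply Rdiv_lt_0_compat; lra |].
      apply Rmult_le_reg_r with k; [lra |]; unfold Rdiv; rewrite Rmult_assoc, Rinv_l; lra. }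
    pose proof (E_BVN_nonneg l (1 - (1 - v) / k) Hl ltac:(apply Rabs_le; lra)); nra.
Qed.

(** [gap / u] is the product of [gap / tau], weakly decreasing by concavity, and [tau / u], strictly
    decreasing; both are positive. *)
Lemma gap_tau_ratio (l k u u' : R) : 0 < l -> 1 <= k -> 0 < u < u' -> u' <= 1 ->
  gap l (tau k u') * u < gap l (tau k u) * u'.
Proof.
  intros Hl Hk Hu Hu'.
  pose proof (tau_pos k u Hk ltac:(lra)) as T; pose proof (tau_pos k u' Hk ltac:(lra)) as T'.
  pose proof (tau_increasing k u u' Hk Hu Hu') as I; pose proof (tau_ratio k u u' Hk Hu Hu') as Q.
  pose proof (gap_ratio_antitone l (tau k u) (tau k u') Hl ltac:(lra)) as A.
  pose proof (gap_increasing l 0 (tau k u) Hl T) as G; rewrite gap_0 in G.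
  apply Rmult_lt_reg_r with (tau k u); [easy |]; nra.
Qed.

Lemma root_exists (l k : R) : 0 < l -> 1 <= k ->
  exists u, 0 < u < 1 /\ gap l (tau k u) = mass l * u.
Proof.
  intros Hl Hk; pose proof (slope_pos l 1 Hl) as S; pose proof (mass_pos l) as M.
  (* The inverse of [u |-> tau k u]. In the variable [t] everything is smooth at 0: [mass l * U t]
     is quadratic there while [gap l t] is at least linear. *)
  pose (U := fun t => 2 * k * t ^ 2 / (1 + t ^ 2)).
  assert (HU : forall t, 0 <= U t < 2 * k).
  { intros t; pose proof (pow2_ge_0 t); unfold U; split; [apply Rle_mult_inv_pos; nra |].
    apply Rmult_lt_reg_r with (1 + t ^ 2); [lra |]; unfold Rdiv; rewrite Rmult_assoc, Rinv_l; nra. }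
  assert (HtU : forall t, 0 <= t -> tau k (U t) = t).
  { intros t Ht; rewrite <- (sqrt_pow2 t) at 2 by easy; unfold tau; f_equal.
    pose proof (pow2_ge_0 t); unfold U; field; split; [lra |].
    replace (2 * k * (1 + t ^ 2) - 2 * k * t ^ 2) with (2 * k) by ring; lra. }
  pose (H := fun t => mass l * U t - gap l t).
  set (t1 := tau k 1).
  assert (Ht1 : 0 < t1 <= 1) by (split; [apply tau_pos; lra | apply tau_le_1; lra]).
  assert (HUt1 : U t1 = 1).
  { unfold U, t1; rewrite tau_sq by lra; field; lra. }
  (* For [d < c] one has [mass l * U d <= 2 * k * mass l * d^2 < d * slope l 1 <= gap l d]. *)
  set (c := slope l 1 / (2 * k * mass l)).
  assert (Hkm : 0 < 2 * k * mass l) by nra.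
  assert (Hc : 0 < c) by now apply Rdiv_lt_0_compat.
  set (d := Rmin t1 c / 2).
  assert (Hd : 0 < d /\ d < t1 /\ d < c).
  { unfold d; pose proof (Rmin_l t1 c); pose proof (Rmin_r t1 c).
    assert (0 < Rmin t1 c) by (apply Rmin_glb_lt; lra); lra. }
  destruct Hd as [Hd0 [Hdt Hdc]].
  assert (Hneg : H d < 0).
  { unfold H; pose proof (slope_le_gap l d Hl ltac:(lra)).
    pose proof (slope_antitone l d 1 Hl ltac:(lra)).
    assert (U d <= 2 * k * d ^ 2).
    { unfold U, Rdiv; rewrite <- (Rmult_1_r (2 * k * d ^ 2)) at 2.
      pose proof (pow2_ge_0 d); apply Rmult_le_compat_l; [nra |].
      rewrite <- Rinv_1; apply Rinv_le_contravar; lra. }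
    assert (mass l * U d <= d * (d * (2 * k * mass l))).
    { replace (d * (d * (2 * k * mass l))) with (mass l * (2 * k * d ^ 2)) by ring.
      apply Rmult_le_compat_l; lra. }
    assert (d * (2 * k * mass l) < slope l 1).
    { replace (slope l 1) with (c * (2 * k * mass l)) by (unfold c; field; lra).
      now apply Rmult_lt_compat_r. }
    nra. }
  assert (Hpos : 0 < H t1) by (unfold H; rewrite HUt1; pose proof (gap_lt_mass l t1); lra).
  destruct (IVT_gen H d t1 0) as [t [Ht1' Ht2]].
  - intros t; apply continuity_pt_filterlim; unfold H, U.
    apply (cont_minus (fun t => mass l * (2 * k * t ^ 2 / (1 + t ^ 2))) (gap l)).
    + apply smooth_cont; auto_derive; nra.
    + apply smooth_cont; eexists; apply is_derive_gap.
  - rewrite Rmin_left, Rmax_right; lra.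
  - rewrite Rmin_left, Rmax_right in Ht1' by lra.
    exists (U t); rewrite HtU by lra; unfold H in Ht2; split; [| lra].
    assert (Hlt : t < t1) by (destruct (Req_dec t t1) as [-> | E]; [unfold H in *; lra | lra]).
    assert (0 < t ^ 2 < t1 ^ 2) by (split; [nra | nra]).
    assert (Hsq : t1 ^ 2 * (2 * k - 1) = 1) by (unfold t1; rewrite tau_sq by lra; field; lra).
    unfold U; split; [apply Rdiv_lt_0_compat; nra |].
    apply Rmult_lt_reg_r with (1 + t ^ 2); [lra |]; unfold Rdiv; rewrite Rmult_assoc, Rinv_l by lra; nra.
Qed.

(** The nontrivial root in the variable [u = 1 - v]. Choice by [epsilon] gives a total function,
    specified only for [0 < l] and [1 <= k]. *)
Definition root (l k : R) : R :=
  epsilon (inhabits 0) (fun u => 0 < u < 1 /\ gap l (tau k u) = mass l * u).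

Lemma root_spec (l k : R) : 0 < l -> 1 <= k ->
  0 < root l k < 1 /\ gap l (tau k (root l k)) = mass l * root l k.
Proof.
  intros Hl Hk; unfold root.
  exact (epsilon_spec (inhabits 0) (fun u => 0 < u < 1 /\ gap l (tau k u) = mass l * u)
    (root_exists l k Hl Hk)).
Qed.

(** [gap / u] crosses the level [mass l] downwards, and only at the root. With [root_gt], this turns
    every monotonicity and limit claim about roots into an inequality at one chosen [u]. *)
Lemma root_lt (l k u : R) : 0 < l -> 1 <= k -> 0 < u <= 1 ->
  (root l k < u <-> gap l (tau k u) < mass l * u).
Proof.
  intros Hl Hk Hu; destruct (root_spec l k Hl Hk) as [R0 R1]; pose proof (mass_pos l); split; intros H1.
  - pose proof (gap_tau_ratio l k (root l k) u Hl Hk ltac:(lra) ltac:(lra)) as G.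
    rewrite R1 in G; apply Rmult_lt_reg_r with (root l k); lra.
  - apply Rnot_le_lt; intros [H2 | H2]; [| rewrite H2 in H1; lra].
    pose proof (gap_tau_ratio l k u (root l k) Hl Hk ltac:(lra) ltac:(lra)) as G.
    rewrite R1 in G; pose proof (Rmult_lt_compat_r (root l k) _ _ ltac:(lra) H1); lra.
Qed.

Lemma root_gt (l k u : R) : 0 < l -> 1 <= k -> 0 < u <= 1 ->
  (u < root l k <-> mass l * u < gap l (tau k u)).
Proof.
  intros Hl Hk Hu; destruct (root_spec l k Hl Hk) as [R0 R1]; pose proof (mass_pos l); split; intros H1.
  - pose proof (gap_tau_ratio l k u (root l k) Hl Hk ltac:(lra) ltac:(lra)) as G.
    rewrite R1 in G; apply Rmult_lt_reg_r with (root l k); lra.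
  - apply Rnot_le_lt; intros [H2 | H2]; [| rewrite <- H2 in H1; lra].
    apply root_lt in H2; lra.
Qed.

Lemma F_zero_iff (l k v : R) (rho : R -> R) : 0 < l -> 1 <= k -> rho v = 1 - (1 - v) / k ->
  -1 <= v <= 1 -> (F l rho v = 0 <-> v = 1 - root l k \/ v = 1).
Proof.
  intros Hl Hk Hrho Hv; destruct (root_spec l k Hl Hk) as [R0 R1].
  destruct (Rle_dec v 0) as [Hv0 | Hv0].
  { pose proof (F_pos l k v rho Hl Hk Hrho ltac:(lra)); split; intros; lra. }
  rewrite (F_eq l k) by (easy || lra); split.
  - intros H; destruct (Req_dec v 1) as [H1 | H1]; [now right | left].
    assert (~ root l k < 1 - v) by (rewrite root_lt by lra; lra).
    assert (~ 1 - v < root l k) by (rewrite root_gt by lra; lra); lra.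
  - intros [-> | ->].
    + replace (1 - (1 - root l k)) with (root l k) by ring; lra.
    + unfold tau; rewrite Rminus_diag; unfold Rdiv; rewrite Rmult_0_l, sqrt_0, gap_0; ring.
Qed.

Lemma root_decreasing_k (l k k' : R) : 0 < l -> 1 <= k < k' -> root l k' < root l k.
Proof.
  intros Hl Hk; destruct (root_spec l k Hl ltac:(lra)) as [R0 R1].
  apply root_lt; [easy | lra | lra |]; rewrite <- R1.
  apply gap_increasing; [easy |]; apply tau_decreasing_k; lra.
Qed.

(** At fixed [tau], [gap / mass = 1 - expect / mass] strictly increases in [l]; at the root for [l]
    it equals [u], so for [l'] it exceeds [u]. *)
Lemma root_increasing_l (l l' k : R) : 0 < l < l' -> 1 <= k -> root l k < root l' k.
Proof.
  intros Hl Hk; destruct (root_spec l k ltac:(lra) Hk) as [R0 R1].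
  apply root_gt; [lra | easy | lra |].
  pose proof (expect_ratio_decreasing l l' (tau k (root l k)) Hl
    (tau_pos k (root l k) Hk ltac:(lra))) as H.
  rewrite !expect_gap, R1 in H; pose proof (mass_pos l).
  apply Rmult_lt_reg_l with (mass l); [easy | lra].
Qed.

Lemma root_small_l (k d : R) : 1 <= k -> 0 < d ->
  exists e, 0 < e /\ forall l, 0 < l < e -> root l k < d.
Proof.
  intros Hk Hd; destruct gap_le_linear as [K HK].
  set (u := Rmin d 1); assert (Hu : 0 < u <= 1 /\ u <= d).
  { unfold u; split; [split; [apply Rmin_glb_lt; lra | apply Rmin_r] | apply Rmin_l]. }
  set (m := mass 1 * u); assert (Hm : 0 < m) by (pose proof (mass_pos 1); unfold m; nra).
  (* For [l < 1], [mass l >= mass 1], so [l * K < mass 1 * u] is enough. *)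
  exists (Rmin 1 (m / (Rabs K + 1))).
  assert (HK1 : 0 < Rabs K + 1) by (pose proof (Rabs_pos K); lra).
  split; [apply Rmin_glb_lt; [lra | now apply Rdiv_lt_0_compat] |].
  intros l [Hl0 Hl]; apply Rmin_Rgt_l in Hl; destruct Hl as [Hl1 Hl2].
  apply Rlt_le_trans with u; [| easy]; apply root_lt; [easy | easy | easy |].
  eapply Rle_lt_trans; [now apply HK |].
  assert (mass 1 <= mass l) by (rewrite (mass_eq 1), (mass_eq l) by lra;
    pose proof (Phi_le (- (1) / 2) (- l / 2) ltac:(lra)); apply Rmult_le_compat_l; [lra | easy]).
  apply Rgt_lt, Rmult_lt_compat_r with (r := Rabs K + 1) in Hl2; [| easy].
  replace (m / (Rabs K + 1) * (Rabs K + 1)) with m in Hl2 by (field; lra).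
  pose proof (Rle_abs K); apply Rle_lt_trans with (l * (Rabs K + 1)); [nra |].
  unfold m in Hl2; nra.
Qed.

Lemma root_large_l (k d : R) : 1 <= k -> 0 < d ->
  exists N, 0 < N /\ forall l, N < l -> 1 - d < root l k.
Proof.
  (* The cap [1 / 2] keeps [u] positive for large [d]. At this fixed [u] the ratio [expect / mass]
     tends to 0 by [expect_le_large], hence falls below [1 - u]. *)
  intros Hk Hd; set (u := 1 - Rmin d (1 / 2)).
  assert (Hu : 0 < u < 1 /\ 1 - d <= u).
  { unfold u; pose proof (Rmin_l d (1 / 2)); pose proof (Rmin_r d (1 / 2)).
    assert (0 < Rmin d (1 / 2)) by (apply Rmin_glb_lt; lra); lra. }
  pose proof (tau_pos k u Hk ltac:(lra)) as Ht; set (t := tau k u) in *.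
  assert (L : is_lim (fun l => 2 * Phi (- (t / 2) * l) + 4 * t * / l) p_infty (2 * 0 + 4 * t * 0)).
  { apply (is_lim_plus' (fun l => 2 * Phi (- (t / 2) * l)) (fun l => 4 * t * / l)).
    - apply (is_lim_scal_l _ 2 p_infty 0), Phi_lim_scaled; lra.
    - apply (is_lim_scal_l _ (4 * t) p_infty 0), filterlim_inv_infty. }
  apply is_lim_spec in L; assert (Hu1 : 0 < 1 - u) by lra.
  destruct (L (mkposreal _ Hu1)) as [N HN]; simpl in HN.
  exists (Rmax N 1); split; [pose proof (Rmax_r N 1); lra |].
  intros l Hl; pose proof (Rmax_l N 1); pose proof (Rmax_r N 1).
  specialize (HN l ltac:(lra)); apply Rabs_def2 in HN.
  apply Rle_lt_trans with u; [easy |]; apply root_gt; [lra | easy | lra |].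
  pose proof (expect_le_large l t ltac:(lra) Ht) as E; rewrite expect_gap in E.
  replace (- t * (l / 2)) with (- (t / 2) * l) in E by field.
  replace (4 * t / l) with (4 * t * / l) in E by reflexivity.
  pose proof (mass_pos l); fold t; nra.
Qed.

Lemma root_large_k (l d : R) : 0 < l -> 0 < d ->
  exists N, 1 <= N /\ forall k, N < k -> root l k < d.
Proof.
  intros Hl Hd; set (u := Rmin d 1); assert (Hu : 0 < u <= 1 /\ u <= d).
  { unfold u; split; [split; [apply Rmin_glb_lt; lra | apply Rmin_r] | apply Rmin_l]. }
  pose proof (slope_pos l 0 Hl) as S; pose proof (mass_pos l) as M.
  (* By [gap_le_slope_0] it suffices that [tau k u < e], that is [2 * k - u > u / e^2]; this follows
     from [k > 1 + u / e^2] because [u <= 1]. *)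
  set (e := mass l * u / slope l 0); assert (He : 0 < e) by (apply Rdiv_lt_0_compat; nra).
  assert (Hee : 0 < u / e ^ 2) by (apply Rdiv_lt_0_compat; nra).
  exists (1 + u / e ^ 2); split; [lra |]; intros k Hk.
  apply Rlt_le_trans with u; [| easy]; apply root_lt; [easy | lra | easy |].
  pose proof (tau_pos k u ltac:(lra) ltac:(lra)) as Ht.
  eapply Rle_lt_trans; [apply gap_le_slope_0; lra |].
  replace (mass l * u) with (e * slope l 0) by (unfold e; field; lra).
  apply Rmult_lt_compat_r; [easy |]; apply Rsqr_incrst_0; [| lra | lra].
  rewrite !Rsqr_pow2, tau_sq by lra.
  apply Rmult_lt_reg_r with (2 * k - u); [lra |].
  replace (u / (2 * k - u) * (2 * k - u)) with u by (field; lra).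
  replace u with (e ^ 2 * (u / e ^ 2)) at 1 by (field; lra).
  apply Rmult_lt_compat_l; [nra | lra].
Qed.

(** A strict inequality at a [u] just below the root for [k = 1] persists for nearby [k] by
    continuity. The opposite bound is [root_decreasing_k]. *)
Lemma root_near_1_k (l d : R) : 0 < l -> 0 < d ->
  exists e, 0 < e /\ forall k, 1 <= k < 1 + e -> root l 1 - d < root l k.
Proof.
  intros Hl Hd; destruct (root_spec l 1 Hl ltac:(lra)) as [R0 R1].
  set (u := Rmax (root l 1 - d / 2) (root l 1 / 2)).
  assert (Hu : 0 < u < root l 1 /\ root l 1 - d < u).
  { unfold u; pose proof (Rmax_l (root l 1 - d / 2) (root l 1 / 2)).
    pose proof (Rmax_r (root l 1 - d / 2) (root l 1 / 2)).
    assert (Rmax (root l 1 - d / 2) (root l 1 / 2) < root l 1) by (apply Rmax_lub_lt; lra); lra. }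
  assert (G : mass l * u < gap l (tau 1 u)) by (apply root_gt; lra).
  assert (C : continuous (fun k => gap l (tau k u)) 1).
  { apply (continuous_comp (fun k => tau k u) (gap l)).
    - unfold tau; apply smooth_cont; auto_derive; repeat split; try lra.
      apply Rmult_lt_0_compat; [lra | apply Rinv_0_lt_compat; lra].
    - apply smooth_cont; eexists; apply is_derive_gap. }
  assert (Hg : 0 < gap l (tau 1 u) - mass l * u) by lra.
  apply filterlim_locally with (eps := mkposreal _ Hg) in C; destruct C as [e He].
  exists e; split; [apply cond_pos |]; intros k Hk.
  apply Rlt_trans with u; [easy |]; apply root_gt; [easy | easy | lra |].
  assert (B : ball 1 e k) by (change (Rabs (k - 1) < e); apply Rabs_def1; lra).
  apply He in B; change (Rabs (gap l (tau k u) - gap l (tau 1 u)) < gap l (tau 1 u) - mass l * u) in B.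
  apply Rabs_def2 in B; lra.
Qed.

(** * Derivative of [F], stability and instability *)

Lemma is_derive_F (l k v : R) (rho : R -> R) : 0 < l -> 1 <= k ->
  (forall v, rho v = 1 - (1 - v) / k) -> 0 < v < 1 ->
  is_derive (F l rho) v
    (slope l (tau k (1 - v)) * (k / (tau k (1 - v) * (2 * k - (1 - v)) ^ 2)) - mass l).
Proof.
  intros Hl Hk Hrho Hv.
  apply (is_derive_ext_loc (fun v => mass l * (1 - v) - gap l (tau k (1 - v)))).
  (* [F_eq] holds only on [[0, 1]], so the two functions are compared on a neighbourhood inside
     it. *)
  - assert (Hm : 0 < Rmin v (1 - v)) by (apply Rmin_glb_lt; lra).
    exists (mkposreal _ Hm); intros y Hy; change (Rabs (y - v) < Rmin v (1 - v)) in Hy.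
    pose proof (Rmin_l v (1 - v)); pose proof (Rmin_r v (1 - v)); apply Rabs_def2 in Hy.
    symmetry; apply F_eq; auto; lra.
  - pose proof (tau_pos k (1 - v) Hk ltac:(lra)) as Ht.
    assert (D : is_derive (fun v => tau k (1 - v)) v (- (k / (tau k (1 - v) * (2 * k - (1 - v)) ^ 2)))).
    { unfold tau in *; auto_derive.
      - repeat split; [lra |]; apply Rmult_lt_0_compat; [lra | apply Rinv_0_lt_compat; lra].
      - change ((1 + - v) * / (2 * k + - (1 + - v))) with ((1 - v) / (2 * k - (1 - v))).
        field; lra. }
    apply (is_derive_ext (fun v => mass l * (1 - v) + - gap l (tau k (1 - v)))); [intros; eqR; ring |].
    replace (_ - mass l) with (- mass l + - (- (k / (tau k (1 - v) * (2 * k - (1 - v)) ^ 2)) *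
      slope l (tau k (1 - v)))) by ring.
    apply (is_derive_plus (V := R_NormedModule)).
    + auto_derive; [easy | ring].
    + apply (is_derive_opp (V := R_NormedModule)).
      apply (is_derive_comp (V := R_NormedModule) (gap l) (fun v => tau k (1 - v)));
        [apply is_derive_gap | exact D].
Qed.

(** At the root, concavity gives [tau * slope <= gap = mass * u], so the derivative is at most
    [mass * (k / (2 * k - u) - 1)], negative because [u < k]. *)
Lemma F_stable (l k : R) (rho : R -> R) : 0 < l -> 1 <= k ->
  (forall v, rho v = 1 - (1 - v) / k) ->
  ex_derive (F l rho) (1 - root l k) /\ Derive (F l rho) (1 - root l k) < 0.
Proof.
  intros Hl Hk Hrho; destruct (root_spec l k Hl Hk) as [R0 R1].
  pose proof (is_derive_F l k (1 - root l k) rho Hl Hk Hrho ltac:(lra)) as D.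
  split; [eexists; exact D |]; rewrite (is_derive_unique _ _ _ D).
  replace (1 - (1 - root l k)) with (root l k) by ring; set (u := root l k) in *.
  pose proof (tau_pos k u Hk ltac:(lra)) as Ht; pose proof (tau_sq k u Hk ltac:(lra)) as Hsq.
  pose proof (slope_le_gap l (tau k u) Hl ltac:(lra)) as S; rewrite R1 in S.
  pose proof (mass_pos l).
  set (t := tau k u) in *; set (s := slope l t) in *.
  assert (E : s * (k / (t * (2 * k - u) ^ 2)) = (t * s) * (k / (u * (2 * k - u)))).
  { replace (u * (2 * k - u)) with (t ^ 2 * (2 * k - u) ^ 2) by (rewrite Hsq; field; lra).
    field; lra. }
  rewrite E.
  assert (Hp : 0 < k / (u * (2 * k - u))) by (apply Rdiv_lt_0_compat; nra).
  assert (t * s * (k / (u * (2 * k - u))) <= mass l * u * (k / (u * (2 * k - u))))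
    by (apply Rmult_le_compat_r; lra).
  replace (mass l * u * (k / (u * (2 * k - u)))) with (mass l * (k / (2 * k - u))) in H0 by (field; lra).
  assert (k / (2 * k - u) < 1).
  { apply Rmult_lt_reg_r with (2 * k - u); [lra |]; unfold Rdiv; rewrite Rmult_assoc, Rinv_l; lra. }
  nra.
Qed.

(** The derivative contains [1 / tau], which blows up as [u] tends to 0, while [slope] stays above
    [slope l 1] because [tau <= 1]. *)
Lemma F_unstable (l k : R) (rho : R -> R) : 0 < l -> 1 <= k ->
  (forall v, rho v = 1 - (1 - v) / k) ->
  at_left 1 (fun v => ex_derive (F l rho) v) /\
  filterlim (Derive (F l rho)) (at_left 1) (Rbar_locally p_infty).
Proof.
  intros Hl Hk Hrho; split.
  - exists (mkposreal 1 Rlt_0_1); intros v Hv Hv1.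
    change (Rabs (v - 1) < 1) in Hv; apply Rabs_def2 in Hv.
    eexists; apply (is_derive_F l k); try easy; lra.
  - intros P [N HN].
    pose proof (slope_pos l 1 Hl) as S; pose proof (mass_pos l) as M.
    set (A := Rabs N + mass l + 1); assert (HA : 0 < A) by (unfold A; pose proof (Rabs_pos N); lra).
    (* Chosen so that [slope l 1 * k / (b * (2 * k)^2) = A]; [u < b^2] ensures [tau <= b]. *)
    set (b := slope l 1 / (4 * k * A)).
    assert (HkA : 0 < 4 * k * A) by nra.
    assert (Hb : 0 < b) by now apply Rdiv_lt_0_compat.
    assert (Hm : 0 < Rmin 1 (b ^ 2)) by (apply Rmin_glb_lt; nra).
    exists (mkposreal _ Hm); intros v Hv Hv1; change (Rabs (v - 1) < Rmin 1 (b ^ 2)) in Hv.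
    pose proof (Rmin_l 1 (b ^ 2)); pose proof (Rmin_r 1 (b ^ 2)); apply Rabs_def2 in Hv.
    apply HN; rewrite (is_derive_unique _ _ _ (is_derive_F l k v rho Hl Hk Hrho ltac:(lra))).
    set (u := 1 - v); assert (Hu : 0 < u < 1 /\ u < b ^ 2) by (unfold u; lra).
    pose proof (tau_pos k u Hk ltac:(lra)) as Ht.
    pose proof (tau_le_1 k u Hk ltac:(lra)) as Ht1.
    assert (Htb : tau k u <= b).
    { eapply Rle_trans; [apply tau_le_sqrt; lra |].
      rewrite <- (sqrt_pow2 b) by lra; apply sqrt_le_1_alt; lra. }
    pose proof (slope_antitone l (tau k u) 1 Hl ltac:(lra)) as Sl.
    set (t := tau k u) in *.
    assert (Q : 1 / (4 * k * b) <= k / (t * (2 * k - u) ^ 2)).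
    { replace (1 / (4 * k * b)) with (k * / (b * (2 * k) ^ 2)) by (field; lra).
      apply Rmult_le_compat_l; [lra |]; apply Rinv_le_contravar;
        [apply Rmult_lt_0_compat; [lra | apply pow_lt; lra] |].
      apply Rmult_le_compat; [lra | apply pow2_ge_0 | easy |]; apply pow_incr; lra. }
    assert (E : A = slope l 1 * (1 / (4 * k * b))) by (unfold b; field; lra).
    assert (Hq : 0 < 1 / (4 * k * b)) by (apply Rdiv_lt_0_compat; nra).
    assert (A <= slope l t * (k / (t * (2 * k - u) ^ 2))) by (rewrite E; apply Rmult_le_compat; lra).
    pose proof (Rle_abs N); unfold A in *; lra.
Qed.

Lemma F_gcrn (l v : R) : 0 < l -> F l rho_gcrn v = mass l * (1 - v).
Proof.
  intros Hl; unfold F, rho_gcrn; rewrite E_BVN_expect_1, expect_0, mass_eq by easy; ring.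
Qed.

Lemma rho_crn_eq (v : R) : rho_crn v = 1 - (1 - v) / 1.
Proof. unfold rho_crn; field. Qed.

Lemma rho_refl_eq (eps v : R) : 1 < eps -> rho_refl eps v = 1 - (1 - v) / (eps / (eps - 1)).
Proof. intros H; unfold rho_refl; field; lra. Qed.

Lemma refl_k_eq (eps : R) : 1 < eps -> eps / (eps - 1) = 1 + / (eps - 1).
Proof. intros; field; lra. Qed.

Lemma refl_k_gt_1 (eps : R) : 1 < eps -> 1 < eps / (eps - 1).
Proof. intros H; rewrite refl_k_eq by easy; pose proof (Rinv_0_lt_compat (eps - 1)); lra. Qed.

Lemma filterlim_within (f : R -> R) (G : (R -> Prop) -> Prop) {FG : Filter G} (c : R) :
  (forall d, 0 < d -> G (fun x => Rabs (f x - c) < d)) -> filterlim f G (locally c).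
Proof.
  intros H; apply filterlim_locally; intros d; apply (H d), cond_pos.
Qed.

Lemma root_l_limits (k : R) : 1 <= k ->
  filterlim (fun l => 1 - root l k) (at_right 0) (locally 1) /\
  filterlim (fun l => 1 - root l k) (Rbar_locally p_infty) (locally 0).
Proof.
  intros Hk; split; apply filterlim_within; try typeclasses eauto; intros d Hd.
  - destruct (root_small_l k d Hk Hd) as [e [He H]].
    exists (mkposreal _ He); intros l Hle Hl; change (Rabs (l - 0) < e) in Hle.
    rewrite Rminus_0_r in Hle; apply Rabs_def2 in Hle.
    destruct (root_spec l k Hl Hk); specialize (H l ltac:(lra)); apply Rabs_def1; lra.
  - destruct (root_large_l k d Hk Hd) as [N [HN H]]; exists N; intros l Hl.
    destruct (root_spec l k ltac:(lra) Hk); specialize (H l Hl); apply Rabs_def1; lra.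
Qed.

Theorem theorem3 :
  exists (v_crn : R -> R) (v_refl : R -> R -> R),
    (* (i) GCRN: unique solution v = 1 *)
    (forall l1, 0 < l1 ->
       forall v, -1 <= v <= 1 -> (F l1 rho_gcrn v = 0 <-> v = 1)) /\
    (* (ii) CRN: solutions v_crn in (0,1) and v_u = 1 *)
    (forall l1, 0 < l1 ->
       0 < v_crn l1 < 1 /\
       forall v, -1 <= v <= 1 ->
         (F l1 rho_crn v = 0 <-> v = v_crn l1 \/ v = 1)) /\
    (* (iii) reflection, eps > 1: solutions v_refl in (v_crn,1) and v_u = 1 *)
    (forall l1 eps, 0 < l1 -> 1 < eps ->
       v_crn l1 < v_refl l1 eps < 1 /\
       forall v, -1 <= v <= 1 ->
         (F l1 (rho_refl eps) v = 0 <-> v = v_refl l1 eps \/ v = 1)) /\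
    (* v_refl strictly decreasing in eps on (1,oo) *)
    (forall l1 e1 e2, 0 < l1 -> 1 < e1 -> e1 < e2 ->
       v_refl l1 e2 < v_refl l1 e1) /\
    (* v_refl -> 1 as eps -> 1+, v_refl -> v_crn as eps -> oo *)
    (forall l1, 0 < l1 ->
       filterlim (fun eps => v_refl l1 eps) (at_right 1) (locally 1) /\
       filterlim (fun eps => v_refl l1 eps) (Rbar_locally p_infty)
                 (locally (v_crn l1))) /\
    (* v_crn, v_refl strictly decreasing in l1 *)
    (forall a b, 0 < a -> a < b -> v_crn b < v_crn a) /\
    (forall eps a b, 1 < eps -> 0 < a -> a < b -> v_refl b eps < v_refl a eps) /\
    (* limits in l1 *)
    filterlim v_crn (at_right 0) (locally 1) /\
    filterlim v_crn (Rbar_locally p_infty) (locally 0) /\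
    (forall eps, 1 < eps ->
       filterlim (fun l1 => v_refl l1 eps) (at_right 0) (locally 1) /\
       filterlim (fun l1 => v_refl l1 eps) (Rbar_locally p_infty) (locally 0)) /\
    (* instability of v_u = 1 : d/dv F -> +oo as v -> 1- (CRN and reflection) *)
    (forall l1, 0 < l1 ->
       at_left 1 (fun v => ex_derive (F l1 rho_crn) v) /\
       filterlim (Derive (F l1 rho_crn)) (at_left 1) (Rbar_locally p_infty)) /\
    (forall l1 eps, 0 < l1 -> 1 < eps ->
       at_left 1 (fun v => ex_derive (F l1 (rho_refl eps)) v) /\
       filterlim (Derive (F l1 (rho_refl eps))) (at_left 1) (Rbar_locally p_infty)) /\
    (* stability: d/dv F < 0 at v_crn, v_refl, v_gcrn = 1 *)
    (forall l1, 0 < l1 ->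
       ex_derive (F l1 rho_crn) (v_crn l1) /\ Derive (F l1 rho_crn) (v_crn l1) < 0) /\
    (forall l1 eps, 0 < l1 -> 1 < eps ->
       ex_derive (F l1 (rho_refl eps)) (v_refl l1 eps) /\
       Derive (F l1 (rho_refl eps)) (v_refl l1 eps) < 0) /\
    (forall l1, 0 < l1 ->
       ex_derive (F l1 rho_gcrn) 1 /\ Derive (F l1 rho_gcrn) 1 < 0).
Proof.
  exists (fun l => 1 - root l 1), (fun l eps => 1 - root l (eps / (eps - 1))).
  assert (K1 : 1 <= 1) by lra.
  split; [| split; [| split; [| split; [| split; [| split; [| split;
    [| split; [| split; [| split; [| split; [| split; [| split; [| split]]]]]]]]]]]]].
  - intros l Hl v Hv; rewrite F_gcrn by easy; pose proof (mass_pos l); split; [nra | intros ->; ring].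
  - intros l Hl; destruct (root_spec l 1 Hl K1); split; [lra |].
    intros v Hv; apply F_zero_iff; [easy | easy | apply rho_crn_eq | easy].
  - intros l eps Hl He; pose proof (refl_k_gt_1 eps He) as K.
    destruct (root_spec l (eps / (eps - 1)) Hl ltac:(lra)).
    pose proof (root_decreasing_k l 1 _ Hl (conj K1 K)); split; [lra |].
    intros v Hv; apply F_zero_iff; [easy | lra | now apply rho_refl_eq | easy].
  - intros l e1 e2 Hl He1 He2.
    enough (root l (e1 / (e1 - 1)) < root l (e2 / (e2 - 1))) by lra.
    apply root_decreasing_k; [easy |]; pose proof (refl_k_gt_1 e2 ltac:(lra)).
    split; [lra |]; rewrite !refl_k_eq by lra.
    apply Rplus_lt_compat_l, Rinv_lt_contravar; [nra | lra].
  - intros l Hl; split; apply filterlim_within; try typeclasses eauto; intros d Hd.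
    (* [eps] near 1 means large [k = 1 + / (eps - 1)]: [eps - 1 < / N] gives [k > N]. *)
    + destruct (root_large_k l d Hl Hd) as [N [HN H]].
      assert (HN' : 0 < / N) by (apply Rinv_0_lt_compat; lra).
      exists (mkposreal _ HN'); intros eps Heps Heps1; change (Rabs (eps - 1) < / N) in Heps.
      rewrite Rabs_pos_eq in Heps by lra.
      pose proof (refl_k_gt_1 eps Heps1) as K.
      destruct (root_spec l (eps / (eps - 1)) Hl ltac:(lra)).
      assert (N < eps / (eps - 1)).
      { rewrite refl_k_eq by easy; apply Rinv_lt_contravar in Heps.
        - rewrite Rinv_inv in Heps; lra.
        - apply Rmult_lt_0_compat; lra. }
      specialize (H _ H2); apply Rabs_def1; lra.
    (* Large [eps] means [k] near 1: [eps > 1 + / e] gives [k < 1 + e]. *)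
    + destruct (root_near_1_k l d Hl Hd) as [e [He H]].
      assert (He' : 0 < / e) by now apply Rinv_0_lt_compat.
      exists (1 + / e); intros eps Heps; pose proof (refl_k_gt_1 eps ltac:(lra)) as K.
      pose proof (root_decreasing_k l 1 _ Hl (conj K1 K)).
      assert (eps / (eps - 1) < 1 + e).
      { rewrite refl_k_eq by lra; apply Rplus_lt_compat_l; rewrite <- (Rinv_inv e).
        apply Rinv_lt_contravar; [nra | lra]. }
      specialize (H (eps / (eps - 1)) ltac:(lra)); apply Rabs_def1; lra.
  - intros a b Ha Hab; pose proof (root_increasing_l a b 1 (conj Ha Hab) K1); lra.
  - intros eps a b He Ha Hab; pose proof (refl_k_gt_1 eps He).
    pose proof (root_increasing_l a b (eps / (eps - 1)) (conj Ha Hab) ltac:(lra)); lra.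
  - now apply root_l_limits.
  - now apply root_l_limits.
  - intros eps He; pose proof (refl_k_gt_1 eps He); apply root_l_limits; lra.
  - intros l Hl; apply (F_unstable l 1); [easy | easy | apply rho_crn_eq].
  - intros l eps Hl He; pose proof (refl_k_gt_1 eps He).
    apply (F_unstable l (eps / (eps - 1))); [easy | lra | intros; now apply rho_refl_eq].
  - intros l Hl; apply (F_stable l 1); [easy | easy | apply rho_crn_eq].
  - intros l eps Hl He; pose proof (refl_k_gt_1 eps He).
    apply (F_stable l (eps / (eps - 1))); [easy | lra | intros; now apply rho_refl_eq].
  - intros l Hl.
    assert (D : is_derive (F l rho_gcrn) 1 (- mass l)).
    { apply (is_derive_ext (fun v => mass l * (1 - v))); [intros; now rewrite F_gcrn |].
      auto_derive; [easy | ring]. }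
    split; [eexists; exact D |]; rewrite (is_derive_unique _ _ _ D); pose proof (mass_pos l); lra.
Qed.
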